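(* Let $e\ge2$, $I=\mathbb{Z}/e\mathbb{Z}$, $r>1$, $\mathbf{s}=(s_1,\dots,s_r)\in I^r$, and let $\lambda,\mu\in\mathcal{P}^r$ with $\mu^{(1)}=\varnothing$. Then the bar involution coefficients satisfy $$b^{\mathbf{s}}_{\lambda\mu}=\begin{cases}b^{\mathbf{s}_-}_{\lambda_-\mu_-}&\text{if }\lambda^{(1)}=\varnothing,\\ 0&\text{otherwise.}\end{cases}$$
   Context: Multipartitions. A partition is a weakly decreasing sequence of non-negative integers with finite sum; $\varnothing=(0,0,\dots)$. $\mathcal{P}^r$ is the set of $r$-multipartitions, i.e. $r$-tuples $\lambda=(\lambda^{(1)},\dots,\lambda^{(r)})$ of partitions. For $r>1$: $\lambda_-=(\lambda^{(2)},\dots,\lambda^{(r)})\in\mathcal{P}^{r-1}$ and $\mathbf{s}_-=(s_2,\dots,s_r)\in I^{r-1}$. Wedges (for given $e\ge 2$, $r\ge1$). A wedge of length $l$ is a symbol $\boxed{t_1}\wedge\dots\wedge\boxed{t_l}$ with $t_i\in\mathbb{Z}$; a semi-infinite wedge of charge $s$ is a symbol $\boxed{t_1}\wedge\boxed{t_2}\wedge\cdots$ with $t_i=s+1-i$ for $i\gg0$. A wedge is ordered if its entries are strictly decreasing. For $t\in\mathbb{Z}$ write uniquely $t=a(t)+e(b(t)-1)-er\,m(t)$ with $a(t)\in\{1,\dots,e\}$, $b(t)\in\{1,\dots,r\}$, $m(t)\in\mathbb{Z}$. For $t\le u$ let $\alpha,\beta\in\{0,\dots,er-1\}$ be the residues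 modulo $er$ of $a(u)-a(t)$ and $e(b(u)-b(t))$. Write $W_x=\boxed{u-x}\wedge\boxed{t+x}$. Straightening relations for $\boxed t\wedge\boxed u$, $t\le u$ (all sums run only as long as the wedges are ordered): if $\alpha=\beta=0$: $\boxed t\wedge\boxed u=-W_0$; if $\alpha>\beta=0$: $\boxed t\wedge\boxed u=-q^{-1}W_0+(q^{-2}-1)\big(\sum_{m\ge0}q^{-2m}W_{\alpha+erm}-\sum_{m\ge1}q^{1-2m}W_{erm}\big)$; if $\beta>\alpha=0$: $\boxed t\wedge\boxed u=-qW_0+(q^2-1)\big(\sum_{m\ge0}q^{2m}W_{\beta+erm}-\sum_{m\ge1}q^{2m-1}W_{erm}\big)$; if $\alpha,\beta>0$: $\boxed t\wedge\boxed u=-W_0+(q-q^{-1})\sum_{m\ge0}\frac{q^{2m+1}+q^{-2m-1}}{q+q^{-1}}W_{\beta+erm}+(q^{-1}-q)\sum_{m\ge0}\frac{q^{2m+1}+q^{-2m-1}}{q+q^{-1}}W_{\alpha+erm}+(q-q^{-1})\sum_{m\ge0}\frac{q^{2m+2}-q^{-2m-2}}{q+q^{-1}}W_{\alpha+\beta+erm}+(q^{-1}-q)\sum_{m\ge1}\frac{q^{2m}-q^{-2m}}{q+q^{-1}}W_{erm}$. Longer and semi-infinite wedges are subject to these relations in each adjacent pair of positions; the wedge spaces are the $\mathbb{Q}(q)$-spans of wedges modulo these relations, and ordered wedges form a basis. Bar involution coefficients. For $\mathbf{s}\in I^r$, a multicharge for $\mathbf{s}$ is $\tilde{\mathbf{s}}=(\tilde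 s_1,\dots,\tilde s_r)\in\mathbb{Z}^r$ with $\tilde s_k+e\mathbb{Z}=s_k$ for each $k$. For $\lambda\in\mathcal{P}^r$ put $\beta^{(k)}_i=\lambda^{(k)}_i+\tilde s_k+1-i$ ($i\ge1$), write $\beta^{(k)}_i=a-em$ with $a\in\{1,\dots,e\}$, $m\in\mathbb Z$, and set $\check\beta^{(k)}_i=a+e(k-1)-erm$. Arranging all the $\check\beta^{(k)}_i$ as $t_1>t_2>\cdots$, set $|\lambda,\tilde{\mathbf{s}}\rangle=\boxed{t_1}\wedge\boxed{t_2}\wedge\cdots$, an ordered semi-infinite wedge of charge $\tilde s_1+\dots+\tilde s_r$. For $\mu\in\mathcal{P}^r$ with $|\mu,\tilde{\mathbf{s}}\rangle=\boxed{t_1}\wedge\boxed{t_2}\wedge\cdots$ and $l\gg0$, straightening gives a finite sum $\boxed{t_l}\wedge\boxed{t_{l-1}}\wedge\dots\wedge\boxed{t_1}\wedge\boxed{t_{l+1}}\wedge\boxed{t_{l+2}}\wedge\dots=\sum_\lambda c_{\lambda\mu}|\lambda,\tilde{\mathbf{s}}\rangle$ with $c_{\mu\mu}\neq0$; put $b^{\tilde{\mathbf{s}}}_{\lambda\mu}=c_{\lambda\mu}/c_{\mu\mu}$ (independent of $l\gg0$). For fixed $\mu$ there is $N$ such that the $b^{\tilde{\mathbf{s}}}_{\lambda\mu}$ are independent of the multicharge $\tilde{\mathbf{s}}$ for $\mathbf{s}$ whenever $\tilde s_k-\tilde s_{k+1}\ge N$ for all $k$ (Yvonne's theorem, taken as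 known); this common value is $b^{\mathbf{s}}_{\lambda\mu}$. (The bar involution on the Fock space $\mathcal{F}^{\mathbf{s}}$ with $\mathbb{Q}(q)$-basis $\{s_\lambda:\lambda\in\mathcal{P}^r\}$ is the map, semilinear with respect to $q\mapsto q^{-1}$, with $\overline{s_\mu}=\sum_\lambda b^{\mathbf{s}}_{\lambda\mu}s_\lambda$.) The coefficients $b^{\mathbf{s}_-}$ are defined in the same way with $r-1$ in place of $r$. *)

(* Defs.v *)
From HB Require Import structures.
From mathcomp Require Import all_boot all_order all_algebra.
From mathcomp Require Import boolp finmap zify.
From mathcomp Require Export monalg.

Set Implicit Arguments.
Unset Strict Implicit.
Unset Printing Implicit Defensive.

Import Order.TTheory GRing.Theory Num.Theory.

Local Open Scope ring_scope.

(* The field Q(q). *)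
Definition Qq := {fraction {poly rat}}.
Definition q : Qq := tofrac 'X.

(* A partition, with its trailing zeros removed. *)
Definition intpart := {p : seq nat | sorted geq p && (0%N \notin p)}.
Definition part (p : intpart) (i : nat) : nat := nth 0%N (sval p) i.
Definition emptypart : intpart := exist _ [::] isT.
Definition multipartition (r : nat) := r.-tuple intpart.

(* The unique a, b, m with t = a + e (b - 1) - e r m, 1 <= a <= e and
   1 <= b <= r (lemma wresE). *)
Definition wres_a (e : nat) (t : int) : int := ((t - 1) %% e)%Z + 1.
Definition wres_b (e r : nat) (t : int) : int :=
  (((t - 1) %% (e * r)%N)%Z %/ e)%Z + 1.
Definition wres_m (e r : nat) (t : int) : int := - ((t - 1) %/ (e * r)%N)%Z.

Lemma wresE (e r : nat) (t a b m : int) :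
  (0 < e)%N -> (0 < r)%N -> 1 <= a <= e%:Z -> 1 <= b <= r%:Z ->
  (t = a + e%:Z * (b - 1) - (e * r)%N%:Z * m) <->
  [/\ a = wres_a e t, b = wres_b e r t & m = wres_m e r t].
Proof.
move=> e0 r0 ha hb; rewrite /wres_a /wres_b /wres_m.
have E0 : (e%:Z != 0) by lia.
have -> : ((t - 1) %% (e * r)%N)%Z = (t - 1) - ((t - 1) %/ (e * r)%N)%Z * (e * r)%N.
  by rewrite {2}(divz_eq (t - 1) (e * r)%N) addrAC subrr add0r.
split=> [ht|[-> -> ->]].
  have hm : ((t - 1) %/ (e * r)%N)%Z = - m.
    have -> : t - 1 = - m * (e * r)%N%:Z + (a - 1 + e%:Z * (b - 1)).
      by rewrite ht; lia.
    rewrite divzMDl; last by lia.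
    by rewrite divz_small ?addr0 //; nia.
  have h1 : t - 1 = (b - 1 - r%:Z * m) * e%:Z + (a - 1) by rewrite ht; lia.
  split; last by rewrite hm opprK.
    by rewrite h1 modzMDl modz_small; lia.
  rewrite hm.
  have -> : t - 1 - - m * (e * r)%N = (b - 1) * e%:Z + (a - 1) by rewrite ht; lia.
  by rewrite divzMDl // (@divz_small (a - 1)); lia.
set Q := ((t - 1) %/ (e * r)%N)%Z.
have -> : t - 1 - Q * (e * r)%N = (- (Q * r%:Z)) * e%:Z + (t - 1) by lia.
rewrite divzMDl //.
have := divz_eq (t - 1) e.
by set d := ((t - 1) %/ e)%Z; set k := ((t - 1) %% e)%Z; nia.
Qed.

Section Wedges.
Variables e r : nat.

Definition alpha (t u : int) : int :=
  ((wres_a e u - wres_a e t) %% (e * r)%N)%Z.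
Definition beta (t u : int) : int :=
  ((e%:Z * (wres_b e r u - wres_b e r t)) %% (e * r)%N)%Z.

Section Straightening.
Variables (V : lmodType Qq) (t u : int) (W : int -> V).

(* The sum over m >= lo of f m *: W (x + e r m), where only the x with
   u - x > t + x contribute; for x >= 0 this forces m < u - t. *)
Definition ordered_sum (lo : nat) (x : int) (f : nat -> Qq) : V :=
  \sum_(lo <= m < `|u - t|%N
        | t + (x + (e * r * m)%N%:Z) < u - (x + (e * r * m)%N%:Z))
    f m *: W (x + (e * r * m)%N%:Z).

(* The right-hand side of the straightening relation for t /\ u, with t <= u,
   where W x stands for (u - x) /\ (t + x). *)
Definition straighten : V :=
  let al := alpha t u in let be := beta t u in
  if (al == 0) && (be == 0) then - W 0
  else if be == 0 then
    - q^-1 *: W 0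
    + (q ^- 2 - 1) *: (ordered_sum 0 al (fun m => q ^- (2 * m))
                       - ordered_sum 1 0 (fun m => q ^- (2 * m).-1))
  else if al == 0 then
    - q *: W 0
    + (q ^+ 2 - 1) *: (ordered_sum 0 be (fun m => q ^+ (2 * m))
                       - ordered_sum 1 0 (fun m => q ^+ (2 * m).-1))
  else
    - W 0
    + (q - q^-1) *: ordered_sum 0 be (fun m =>
        (q ^+ (2 * m + 1) + q ^- (2 * m + 1)) / (q + q^-1))
    + (q^-1 - q) *: ordered_sum 0 al (fun m =>
        (q ^+ (2 * m + 1) + q ^- (2 * m + 1)) / (q + q^-1))
    + (q - q^-1) *: ordered_sum 0 (al + be) (fun m =>
        (q ^+ (2 * m + 2) - q ^- (2 * m + 2)) / (q + q^-1))
    + (q^-1 - q) *: ordered_sum 1 0 (fun m =>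
        (q ^+ (2 * m) - q ^- (2 * m)) / (q + q^-1)).

End Straightening.

(* A semi-infinite wedge is the sequence of its entries, numbered from 0. *)
Definition wedge := nat -> int.

Definition has_charge (s : int) (w : wedge) : Prop :=
  exists n : nat, forall i : nat, (n <= i)%N -> w i = s - i%:Z.

(* w with the entries in positions i and i + 1 replaced by x and y *)
Definition set_pair (w : wedge) (i : nat) (x y : int) : wedge :=
  fun j => if j == i then x else if j == i.+1 then y else w j.

Definition relator (w : wedge) (i : nat) : {malg Qq[wedge]} :=
  << w >> - straighten (w i) (w i.+1)
              (fun x => << set_pair w i (w i.+1 - x) (w i + x) >>).

(* The span of the relators between wedges of charge s; the wedge space of
   charge s is the quotient by it of the span of the wedges of charge s. *)
Inductive relators_span (s : int) : {malg Qq[wedge]} -> Prop :=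
| relators_span0 : relators_span s 0
| relators_spanD (a : Qq) (w : wedge) (i : nat) (x : {malg Qq[wedge]}) :
    has_charge s w -> w i <= w i.+1 -> relators_span s x ->
    relators_span s (a *: relator w i + x).

Definition wedge_eq (s : int) (x y : {malg Qq[wedge]}) : Prop :=
  relators_span s (x - y).

Implicit Types (lam mu : multipartition r) (st : r.-tuple int).

(* beta^(k)_i, with i and k numbered from 0 *)
Definition beta_number lam st (k : 'I_r) (i : nat) : int :=
  (part (tnth lam k) i)%:Z + tnth st k - i%:Z.

(* For r = 1 the decomposition of wresE reads t = a - e m. *)
Definition beta_check lam st (k : 'I_r) (i : nat) : int :=
  let t := beta_number lam st k i in
  wres_a e t + (e * k)%N%:Z - (e * r)%N%:Z * wres_m e 1 t.

(* For each k the numbers beta_check lam st k i decrease strictly with i, so the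
   n + 1 largest elements of their union over k all have i <= n. *)
Definition ket st lam : wedge := fun n =>
  nth 0 (sort >=%R [seq beta_check lam st k i | k <- enum 'I_r, i <- iota 0 n.+1])
      n.

Definition charge st : int := \sum_(k < r) tnth st k.

Definition rev_prefix (l : nat) (w : wedge) : wedge :=
  fun i => if (i < l)%N then w (l - i.+1)%N else w i.

(* c is the family of coefficients of w in the basis of the |lam, st>. *)
Definition is_expansion st (w : wedge) (c : {malg Qq[multipartition r]}) : Prop :=
  unique (fun c' : {malg Qq[multipartition r]} =>
    wedge_eq (charge st) << w >> (\sum_(lam <- msupp c') c'@_lam *: << ket st lam >>))
  c.

Definition is_charged_bar_coeff st lam mu (b : Qq) : Prop :=
  exists L : nat, forall l : nat, (L <= l)%N ->
  exists c : {malg Qq[multipartition r]},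
    [/\ is_expansion st (rev_prefix l (ket st mu)) c, c@_mu != 0
      & b = c@_lam / c@_mu].

Definition is_multicharge (s : r.-tuple 'Z_e) st : Prop :=
  forall k : 'I_r, (tnth st k)%:~R = tnth s k.

(* b lam mu is the common value of the coefficients for all the multicharges
   for s that are sufficiently dominant in terms of mu. *)
Definition is_bar_coeffs (s : r.-tuple 'Z_e)
    (b : multipartition r -> multipartition r -> Qq) : Prop :=
  forall mu, exists N : int, forall st,
    is_multicharge s st ->
    (forall k k' : 'I_r, k' = k.+1 :> nat -> N <= tnth st k - tnth st k') ->
    forall lam, is_charged_bar_coeff st lam mu (b lam mu).

End Wedges.

(* Main.v *)
Require Import Defs.
From mathcomp Require Import all_boot all_order all_algebra.
From mathcomp Require Import boolp finmap zify.

(* The integers with b >= 2 at level r are an order-preserving copy of all the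
   integers at level r - 1, and this copy is compatible with the straightening
   relations, since these only involve the residues a, b and the quotients m of
   the two entries. Take a multicharge whose first component is much larger than
   the others. Since mu^(1) is empty, the entries of |mu> with b = 1 fill all the
   available places below the largest entry of |mu>. Straightening preserves the
   number of entries with b = 1 and the range of the entries, so the b = 1 entries
   of every wedge in the expansion are the same as in |mu>, that is,
   lambda^(1) is empty; moreover, moving a b = 1 entry past the others in order to
   collect them at the left only costs a scalar, because all the other terms of the
   relation have too many entries with b = 1. After this the remaining entries are
   straightened exactly as at level r - 1. The scalar produced by moving the b = 1
   entries back depends only on the sum of the quotients m, which straightening
   preserves, so all scalars cancel in c_{lambda mu} / c_{mu mu}. *)

Set Implicit Arguments.
Unset Strict Implicit.
Unset Printing Implicit Defensive.

Import Order.TTheory GRing.Theory Num.Theory.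

Local Open Scope ring_scope.

(** * Linear calculus modulo the relators *)

Section RelatorsSpan.
Variables (e r : nat) (s : int).

Lemma relators_span_add (x y : {malg Qq[wedge]}) :
  relators_span e r s x -> relators_span e r s y -> relators_span e r s (x + y).
Proof.
by elim=> [|a w i z hw hi _ IH] hy; rewrite ?add0r // -addrA; apply/relators_spanD/IH.
Qed.

Lemma relators_span_scale (c : Qq) (x : {malg Qq[wedge]}) :
  relators_span e r s x -> relators_span e r s (c *: x).
Proof.
elim=> [|a w i z hw hi _ IH]; first by rewrite scaler0; constructor.
by rewrite scalerDr scalerA; apply: relators_spanD.
Qed.

Lemma wedge_eq_refl x : wedge_eq e r s x x.
Proof. by rewrite /wedge_eq subrr; constructor. Qed.

Lemma wedge_eqD x y x' y' :
  wedge_eq e r s x y -> wedge_eq e r s x' y' -> wedge_eq e r s (x + x') (y + y').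
Proof. by rewrite /wedge_eq opprD addrACA; apply: relators_span_add. Qed.

Lemma wedge_eqZ c x y : wedge_eq e r s x y -> wedge_eq e r s (c *: x) (c *: y).
Proof. by rewrite /wedge_eq -scalerBr; apply: relators_span_scale. Qed.

Lemma wedge_eq_trans y x z :
  wedge_eq e r s x y -> wedge_eq e r s y z -> wedge_eq e r s x z.
Proof. by move=> h /(relators_span_add h); rewrite subrKA. Qed.

Lemma wedge_eq_transr c d x y z :
  wedge_eq e r s x (c *: y) -> wedge_eq e r s y (d *: z) ->
  wedge_eq e r s x ((c * d) *: z).
Proof.
by move=> hx /(wedge_eqZ c); rewrite scalerA; apply: wedge_eq_trans.
Qed.

End RelatorsSpan.

(** * Coordinates of wedge entries *)

(** Here [a] and [b] are numbered from 0 and [n] is the opposite of the quotient m, so that the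
    order of the integers becomes the lexicographic order of [(n, b, a)]. *)
Definition pt (e r : nat) (a b n : int) : int := 1 + a + e%:Z * (b + r%:Z * n).

Section Coordinates.
Variables e r : nat.
Hypotheses (e_gt0 : (0 < e)%N) (r_gt0 : (0 < r)%N).

Lemma wres_pt a b n : 0 <= a < e%:Z -> 0 <= b < r%:Z ->
  [/\ wres_a e (pt e r a b n) = a + 1, wres_b e r (pt e r a b n) = b + 1
    & wres_m e r (pt e r a b n) = - n].
Proof.
move=> ha hb.
have [] := (@wresE e r (pt e r a b n) (a + 1) (b + 1) (- n) e_gt0 r_gt0).
- by lia.
- by lia.
by case=> [|<- <- <-] //; rewrite /pt; lia.
Qed.

Lemma ptP t : exists a b n : int,
  [/\ 0 <= a < e%:Z, 0 <= b < r%:Z & t = pt e r a b n].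
Proof.
exists ((t - 1) %% e)%Z, (((t - 1) %/ e)%Z %% r)%Z, (((t - 1) %/ e)%Z %/ r)%Z.
rewrite !modz_ge0 ?ltz_pmod; try lia.
split=> //; rewrite /pt.
have := divz_eq (t - 1) e; have := divz_eq ((t - 1) %/ e)%Z r.
set u := ((t - 1) %/ e)%Z; set v := (u %/ r)%Z; nia.
Qed.

(** This is mixed-radix notation with digits [a] in base [e] and [b] in base [r]; [key] compares one
    digit at a time. *)
Lemma pt_lt a b n a' b' n' : 0 <= a < e%:Z -> 0 <= b < r%:Z ->
  0 <= a' < e%:Z -> 0 <= b' < r%:Z ->
  (pt e r a b n < pt e r a' b' n') =
  (n < n') || (n == n') && ((b < b') || (b == b') && (a < a')).
Proof.
move=> ha hb ha' hb'; rewrite /pt.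
have key x x' y y' : 0 <= x < e%:Z -> 0 <= x' < e%:Z ->
  (1 + x + e%:Z * y < 1 + x' + e%:Z * y') = (y < y') || (y == y') && (x < x').
  by move=> hx hx'; case: (ltgtP y y') => h /=; nia.
rewrite key //.
case: (ltgtP n n') => h /=; nia.
Qed.

Variables (a b n a' b' n' : int).
Hypotheses (ha : 0 <= a < e%:Z) (hb : 0 <= b < r%:Z)
  (ha' : 0 <= a' < e%:Z) (hb' : 0 <= b' < r%:Z).

(** The difference [a' - a] lies strictly between [-er] and [er], so reducing it takes at most one
    added [er], recorded by the boolean. The same applies to [e (b' - b)] in [beta_pt]. *)
Lemma alpha_pt : alpha e r (pt e r a b n) (pt e r a' b' n') =
  a' - a + (e * r)%N%:Z * (a' < a)%R%:Z.
Proof.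
rewrite /alpha; have [-> _ _] := wres_pt n ha hb; have [-> _ _] := wres_pt n' ha' hb'.
have -> : a' + 1 - (a + 1) =
  - (a' < a)%R%:Z * (e * r)%N%:Z + (a' - a + (e * r)%N%:Z * (a' < a)%R%:Z) by lia.
by rewrite modzMDl modz_small //; case: ltP; nia.
Qed.

Lemma beta_pt : beta e r (pt e r a b n) (pt e r a' b' n') =
  e%:Z * (b' - b) + (e * r)%N%:Z * (b' < b)%R%:Z.
Proof.
rewrite /beta; have [_ -> _] := wres_pt n ha hb; have [_ -> _] := wres_pt n' ha' hb'.
have -> : e%:Z * (b' + 1 - (b + 1)) =
  - (b' < b)%R%:Z * (e * r)%N%:Z + (e%:Z * (b' - b) + (e * r)%N%:Z * (b' < b)%R%:Z) by lia.
by rewrite modzMDl modz_small //; case: ltP; nia.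
Qed.

End Coordinates.

(** * The straightening relations in coordinates *)

(** [Q m] and [P m] are the left and right entries of the term of index [m]. The bound [M] is a free
    parameter so that sums at two different levels can share it. *)
Definition coord_sum (V : lmodType Qq) (M : nat) (F : int -> int -> V)
    (lo : nat) (P Q : int -> int) (f : nat -> Qq) : V :=
  \sum_(lo <= m < M | P m%:Z < Q m%:Z) f m *: F (Q m%:Z) (P m%:Z).

(* [straighten] written in terms of the residues and quotients of the two
   entries; unlike [alpha], [beta] and the shifts in [straighten], this makes
   sense verbatim for any family [p] of integers indexed by triples. *)
Definition coord_straighten (V : lmodType Qq) (M : nat)
    (p : int -> int -> int -> int) (a b n a' b' n' : int)
    (F : int -> int -> V) : V :=
  let S := coord_sum M F in
  let i := (a' < a)%R%:Z in let j := (b' < b)%R%:Z in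
  let W0 := F (p a' b' n') (p a b n) in
  let Sal lo f := S lo (fun m => p a' b (n + i + m)) (fun m => p a b' (n' - i - m)) f in
  let Sbe lo f := S lo (fun m => p a b' (n + j + m)) (fun m => p a' b (n' - j - m)) f in
  let Sab lo f := S lo (fun m => p a' b' (n + (i + j) + m))
                       (fun m => p a b (n' - (i + j) - m)) f in
  let S0 lo f := S lo (fun m => p a b (n + m)) (fun m => p a' b' (n' - m)) f in
  if (a == a') && (b == b') then - W0
  else if b == b' then
    - q^-1 *: W0
    + (q ^- 2 - 1) *: (Sal 0%N (fun m => q ^- (2 * m)) - S0 1%N (fun m => q ^- (2 * m).-1))
  else if a == a' then
    - q *: W0
    + (q ^+ 2 - 1) *: (Sbe 0%N (fun m => q ^+ (2 * m)) - S0 1%N (fun m => q ^+ (2 * m).-1))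
  else
    - W0
    + (q - q^-1) *: Sbe 0%N (fun m =>
        (q ^+ (2 * m + 1) + q ^- (2 * m + 1)) / (q + q^-1))
    + (q^-1 - q) *: Sal 0%N (fun m =>
        (q ^+ (2 * m + 1) + q ^- (2 * m + 1)) / (q + q^-1))
    + (q - q^-1) *: Sab 0%N (fun m =>
        (q ^+ (2 * m + 2) - q ^- (2 * m + 2)) / (q + q^-1))
    + (q^-1 - q) *: S0 1%N (fun m =>
        (q ^+ (2 * m) - q ^- (2 * m)) / (q + q^-1)).

Section Straightening.
Variables e r : nat.
Hypotheses (e_gt0 : (0 < e)%N) (r_gt0 : (0 < r)%N).

(** The ordering condition already forces [m] below the distance from [t] to [u], so extending the
    range to [M] adds no term. *)
Lemma ordered_sumE (V : lmodType Qq) t u M (F : int -> int -> V) lo x P Q f :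
  (`|u - t| <= M)%N -> 0 <= x ->
  (forall m : int, P m = t + (x + (e * r)%N%:Z * m)) ->
  (forall m : int, Q m = u - (x + (e * r)%N%:Z * m)) ->
  ordered_sum e r t u (fun x => F (u - x) (t + x)) lo x f = coord_sum M F lo P Q f.
Proof.
move=> hM hx hP hQ; rewrite /ordered_sum /coord_sum.
have er_gt0 : (0 < e * r)%N by rewrite muln_gt0 e_gt0.
have hE m : (e * r * m)%N%:Z = (e * r)%N%:Z * m%:Z by lia.
rewrite [RHS](big_nat_widenl _ 0%N) // [LHS](big_nat_widenl _ 0%N) //.
rewrite [LHS](big_nat_widen _ _ M) //.
apply: eq_big => [m|m _]; rewrite hP hQ hE //.
case: (ltrP _ (u - _)) => //= h.
have -> : (m < `|u - t|)%N by nia.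
by rewrite andbT.
Qed.

Variables (a b n a' b' n' : int).
Hypotheses (ha : 0 <= a < e%:Z) (hb : 0 <= b < r%:Z)
  (ha' : 0 <= a' < e%:Z) (hb' : 0 <= b' < r%:Z).

(** A shift by [alpha] exchanges [a] and [a'] and transfers [i] between the quotients; a shift by
    [beta] exchanges [b] and [b'] and transfers [j]; the shift by [alpha + beta] does both, and a
    multiple of [er] only changes the quotients. *)
Lemma straightenE (V : lmodType Qq) M (F : int -> int -> V) t u :
  t = pt e r a b n -> u = pt e r a' b' n' -> (`|u - t| <= M)%N ->
  straighten e r t u (fun x => F (u - x) (t + x)) =
  coord_straighten M (pt e r) a b n a' b' n' F.
Proof.
move=> ht hu hM; rewrite /straighten /coord_straighten.
have hal : alpha e r t u = a' - a + (e * r)%N%:Z * (a' < a)%R%:Z.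
  by rewrite ht hu alpha_pt.
have hbe : beta e r t u = e%:Z * (b' - b) + (e * r)%N%:Z * (b' < b)%R%:Z.
  by rewrite ht hu beta_pt.
have al_ge0 : 0 <= alpha e r t u by rewrite hal; case: ltrP; nia.
have be_ge0 : 0 <= beta e r t u by rewrite hbe; case: ltrP; nia.
have -> : (alpha e r t u == 0) = (a == a') by rewrite hal; case: ltrP; nia.
have -> : (beta e r t u == 0) = (b == b') by rewrite hbe; case: ltrP; nia.
set i := (a' < a)%R%:Z in hal *; set j := (b' < b)%R%:Z in hbe *.
have h0 lo f := @ordered_sumE V t u M F lo 0 (fun m => pt e r a b (n + m))
  (fun m => pt e r a' b' (n' - m)) f hM (lexx _).
have h1 lo f := @ordered_sumE V t u M F lo _ (fun m => pt e r a' b (n + i + m))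
  (fun m => pt e r a b' (n' - i - m)) f hM al_ge0.
have h2 lo f := @ordered_sumE V t u M F lo _ (fun m => pt e r a b' (n + j + m))
  (fun m => pt e r a' b (n' - j - m)) f hM be_ge0.
have h3 lo f := @ordered_sumE V t u M F lo _ (fun m => pt e r a' b' (n + (i + j) + m))
  (fun m => pt e r a b (n' - (i + j) - m)) f hM (addr_ge0 al_ge0 be_ge0).
rewrite hal hbe in h1 h2 h3 *.
rewrite subr0 addr0 -ht -hu !h0 ?h1 ?h2 ?h3 //;
  by move=> m; rewrite ?ht ?hu /pt; lia.
Qed.

End Straightening.

(* The order embedding of the integers with [1 <= b <= r] at level [r] onto the
   integers with [2 <= b <= r + 1] at level [r + 1]. *)
Definition level_up (e r : nat) (t : int) : int :=
  t + e%:Z + e%:Z * ((t - 1) %/ (e * r)%N)%Z.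

(** * Compatibility of straightening with the passage from level [r] to level [r + 1] *)

Section LevelUp.
Variables e r : nat.
Hypotheses (e_gt0 : (0 < e)%N) (r_gt0 : (0 < r)%N).

Lemma level_up_pt a b n : 0 <= a < e%:Z -> 0 <= b < r%:Z ->
  level_up e r (pt e r a b n) = pt e r.+1 a (b + 1) n.
Proof.
move=> ha hb; rewrite /level_up.
have -> : ((pt e r a b n - 1) %/ (e * r)%N)%Z = n.
  have -> : pt e r a b n - 1 = n * (e * r)%N%:Z + (a + e%:Z * b) by rewrite /pt; lia.
  by rewrite divzMDl ?divz_small ?addr0 //; nia.
by rewrite /pt; lia.
Qed.

Lemma level_up_lt t u : (level_up e r t < level_up e r u) = (t < u).
Proof.
have [a [b [n [ha hb ->]]]] := ptP e_gt0 r_gt0 t.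
have [a' [b' [n' [ha' hb' ->]]]] := ptP e_gt0 r_gt0 u.
rewrite !level_up_pt // !pt_lt //; lia.
Qed.

(** In coordinates the passage only replaces [b] and [b'] by [b + 1] and [b' + 1]. This changes
    neither the comparisons that select the case and the carries nor the ordering conditions on the
    terms. *)
Lemma straighten_level_up (V : lmodType Qq) t u (F : int -> int -> V) :
  let t' := level_up e r t in let u' := level_up e r u in
  straighten e r.+1 t' u' (fun x => F (u' - x) (t' + x)) =
  straighten e r t u
    (fun x => F (level_up e r (u - x)) (level_up e r (t + x))).
Proof.
have [a [b [n [ha hb ht]]]] := ptP e_gt0 r_gt0 t.
have [a' [b' [n' [ha' hb' hu]]]] := ptP e_gt0 r_gt0 u.
move=> t' u'; pose M := maxn `|u - t| `|u' - t'|.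
have ht' : t' = pt e r.+1 a (b + 1) n by rewrite /t' ht level_up_pt.
have hu' : u' = pt e r.+1 a' (b' + 1) n' by rewrite /u' hu level_up_pt.
have hb1 : 0 <= b + 1 < r.+1%:Z by lia.
have hb1' : 0 <= b' + 1 < r.+1%:Z by lia.
rewrite (straightenE e_gt0 (ltn0Sn r) ha hb1 ha' hb1' F ht' hu' (leq_maxr _ _ : _ <= M)%N).
pose G x y := F (level_up e r x) (level_up e r y).
rewrite (straightenE e_gt0 r_gt0 ha hb ha' hb' G ht hu (leq_maxl _ _ : _ <= M)%N).
have key lo P Q P' Q' f : (forall m : int, level_up e r (P m) = P' m) ->
    (forall m : int, level_up e r (Q m) = Q' m) ->
    coord_sum M F lo P' Q' f = coord_sum M G lo P Q f.
  move=> hP hQ; apply: eq_big => [m|m _]; rewrite /G -hP -hQ //.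
  by rewrite level_up_lt.
rewrite /coord_straighten /G !level_up_pt // (can_eq (addrK _)) ltrD2r.
by do ![congr (if _ then _ else _)] => //; rewrite -/G;
   do ![congr (_ + _) | congr (_ *: _) | congr (- _)];
   apply: key => m; rewrite level_up_pt.
Qed.

End LevelUp.

(* The exchanges (t, u) -> (u - x, t + x) that occur in the straightening
   relations. *)
Definition exchange (e r : nat) (t u x : int) : Prop :=
  [/\ 0 <= x, t + x < u - x,
      perm_eq [:: wres_a e (u - x); wres_a e (t + x)] [:: wres_a e t; wres_a e u],
      perm_eq [:: wres_b e r (u - x); wres_b e r (t + x)] [:: wres_b e r t; wres_b e r u]
    & wres_m e r (u - x) + wres_m e r (t + x) = wres_m e r t + wres_m e r u].

(** The coefficient of [- W 0] in [straighten] for [t < u]: up to sign, the cost of swapping two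
    entries when all other terms vanish. *)
Definition swap_coeff (e r : nat) (t u : int) : Qq :=
  if alpha e r t u == 0 then if beta e r t u == 0 then 1 else q
  else if beta e r t u == 0 then q^-1 else 1.

Lemma perm_swap2 (T : eqType) (x y : T) : perm_eq [:: x; y] [:: y; x].
Proof. by apply/permP => p /=; rewrite addnCA addnA addnAC addnC. Qed.

(** * The terms of a straightening relation *)

Section Exchange.
Variables e r : nat.
Hypotheses (e_gt0 : (0 < e)%N) (r_gt0 : (0 < r)%N).

Lemma exchange0 t u : t < u -> exchange e r t u 0.
Proof. by move=> h; split; rewrite ?subr0 ?addr0 ?perm_swap2 1?addrC. Qed.

Lemma exchange_shift t u x x0 (m : nat) :
  x0 \in [:: alpha e r t u; beta e r t u; alpha e r t u + beta e r t u; 0] ->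
  x = x0 + (e * r * m)%N%:Z -> t + x < u - x -> exchange e r t u x.
Proof.
have [a [b [n [ha hb ht]]]] := ptP e_gt0 r_gt0 t.
have [a' [b' [n' [ha' hb' hu]]]] := ptP e_gt0 r_gt0 u.
move=> hx0 hx hlt.
have hal : alpha e r t u = a' - a + (e * r)%N%:Z * (a' < a)%R%:Z.
  by rewrite ht hu alpha_pt.
have hbe : beta e r t u = e%:Z * (b' - b) + (e * r)%N%:Z * (b' < b)%R%:Z.
  by rewrite ht hu beta_pt.
have al_ge0 : 0 <= alpha e r t u by rewrite hal; case: ltrP; nia.
have be_ge0 : 0 <= beta e r t u by rewrite hbe; case: ltrP; nia.
have x_ge0 : 0 <= x.
  by move: hx0; rewrite hx !inE => /or4P[] /eqP ->; lia.
(* [al] and [be] are the residues taken by the right entry [t + x]. The left entry gets the two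
   remaining ones, and the quotients move by opposite amounts [i]. *)
have main al be i : 0 <= al < e%:Z -> 0 <= be < r%:Z ->
  (al = a /\ be = b) \/ (al = a' /\ be = b) \/ (al = a /\ be = b') \/ (al = a' /\ be = b') ->
  t + x = pt e r al be (n + i) ->
  u - x = pt e r (a + a' - al) (b + b' - be) (n' - i) -> exchange e r t u x.
  move=> hal' hbe' hc h1 h2.
  have hr1 : 0 <= a + a' - al < e%:Z by lia.
  have hr2 : 0 <= b + b' - be < r%:Z by lia.
  split=> //; rewrite h1 h2 ht hu.
  - have [-> _ _] := wres_pt e_gt0 r_gt0 (n' - i) hr1 hr2.
    have [-> _ _] := wres_pt e_gt0 r_gt0 (n + i) hal' hbe'.
    have [-> _ _] := wres_pt e_gt0 r_gt0 n ha hb.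
    have [-> _ _] := wres_pt e_gt0 r_gt0 n' ha' hb'.
    have [->|->] : al = a \/ al = a' by lia.
      by rewrite [a + a']addrC addrK perm_swap2.
    by rewrite addrK.
  - have [_ -> _] := wres_pt e_gt0 r_gt0 (n' - i) hr1 hr2.
    have [_ -> _] := wres_pt e_gt0 r_gt0 (n + i) hal' hbe'.
    have [_ -> _] := wres_pt e_gt0 r_gt0 n ha hb.
    have [_ -> _] := wres_pt e_gt0 r_gt0 n' ha' hb'.
    have [->|->] : be = b \/ be = b' by lia.
      by rewrite [b + b']addrC addrK perm_swap2.
    by rewrite addrK.
  - have [_ _ ->] := wres_pt e_gt0 r_gt0 (n' - i) hr1 hr2.
    have [_ _ ->] := wres_pt e_gt0 r_gt0 (n + i) hal' hbe'.
    have [_ _ ->] := wres_pt e_gt0 r_gt0 n ha hb.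
    have [_ _ ->] := wres_pt e_gt0 r_gt0 n' ha' hb'.
    lia.
move: hx0; rewrite !inE => /or4P[] /eqP hx0.
- by apply: (main a' b ((a' < a)%R%:Z + m)) => //;
    rewrite ?hx ?hx0 ?hal ?hbe ?ht ?hu /pt; lia.
- by apply: (main a b' ((b' < b)%R%:Z + m)) => //;
    rewrite ?hx ?hx0 ?hal ?hbe ?ht ?hu /pt; lia.
- by apply: (main a' b' ((a' < a)%R%:Z + (b' < b)%R%:Z + m)) => //;
    rewrite ?hx ?hx0 ?hal ?hbe ?ht ?hu /pt; lia.
- by apply: (main a b m) => //; rewrite ?hx ?hx0 ?hal ?hbe ?ht ?hu /pt; lia.
Qed.

(** The added multiple of [W 0] cancels the leading term. Every other term has [x > 0]: the residues
    used as shifts from [m = 0] on are non-zero, and the sums with shift 0 start at [m = 1]. *)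
Lemma straighten_closed (V : lmodType Qq) (P : V -> Prop) t u (W : int -> V) :
  P 0 -> (forall x y, P x -> P y -> P (x + y)) -> (forall c x, P x -> P (c *: x)) ->
  (forall x, 0 < x -> exchange e r t u x -> P (W x)) ->
  P (straighten e r t u W + swap_coeff e r t u *: W 0).
Proof.
move=> P0 PD PZ PW.
have PN x : P x -> P (- x) by move=> h; rewrite -scaleN1r; apply: PZ.
have Psum lo x0 f :
    x0 \in [:: alpha e r t u; beta e r t u; alpha e r t u + beta e r t u; 0] ->
    0 <= x0 -> (x0 != 0) || (0 < lo)%N -> P (ordered_sum e r t u W lo x0 f).
  move=> hx0 x0_ge0 h; rewrite /ordered_sum big_nat_cond.
  apply: big_ind => // m /andP[hm hlt]; apply: PZ; apply: PW.
    have [m0|m_neq0] := eqVneq m 0%N.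
      by move: hm; rewrite m0 leqn0 muln0 addr0 lt0r x0_ge0 andbT; lia.
    have : (0 < e * r * m)%N by rewrite !muln_gt0 e_gt0 r_gt0 lt0n.
    by lia.
  exact: exchange_shift hx0 _ hlt.
have er_neq0 : (e * r)%N%:Z != 0 by rewrite -lt0n muln_gt0 e_gt0.
have al_ge0 : 0 <= alpha e r t u by apply: modz_ge0.
have be_ge0 : 0 <= beta e r t u by apply: modz_ge0.
move: al_ge0 be_ge0 Psum; rewrite /straighten /swap_coeff.
move: (alpha e r t u) (beta e r t u) => al be al_ge0 be_ge0 Psum.
case: (eqVneq al 0) => [al0|al_neq0]; case: (eqVneq be 0) => [be0|be_neq0] /=.
- by rewrite scale1r addNr.
- rewrite addrAC scaleNr addNr add0r; apply/PZ/PD; last apply: PN.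
    by apply: Psum; rewrite ?inE ?eqxx ?orbT ?be_neq0.
  by apply: Psum; rewrite ?inE ?eqxx ?orbT.
- rewrite addrAC scaleNr addNr add0r; apply/PZ/PD; last apply: PN.
    by apply: Psum; rewrite ?inE ?eqxx ?orbT ?al_neq0.
  by apply: Psum; rewrite ?inE ?eqxx ?orbT.
- rewrite scale1r addrC !addrA subrr add0r.
  apply: (PD); [apply: (PD); [apply: (PD)|]|]; apply: (PZ); apply: (Psum);
    rewrite ?inE ?eqxx ?orbT ?addr_ge0 //; lia.
Qed.

(** This serves for the two projections of a product module, where two straightenings are performed
    at once. *)
Lemma straighten_linear (V V' : lmodType Qq) (f : {linear V -> V'}) t u W :
  f (straighten e r t u W) = straighten e r t u (f \o W).
Proof.
have fsum lo x g : f (ordered_sum e r t u W lo x g) =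
    ordered_sum e r t u (f \o W) lo x g.
  by rewrite /ordered_sum linear_sum; apply: eq_bigr => m _; rewrite linearZ.
rewrite /straighten; do ![case: ifP => _];
  do 3?[rewrite ?(linearN, linearD, linearZ) /=]; rewrite ?fsum //. 
Qed.

End Exchange.

(** * Straightening finite segments *)

Lemma gt_int_trans : transitive (>%R : rel int).
Proof. by move=> y x z /= h /lt_trans; apply. Qed.

Lemma gt_sorted_uniq_int (s : seq int) : sorted >%R s -> uniq s.
Proof. by apply: sorted_uniq; [apply: gt_int_trans | move=> x; rewrite /= ltxx]. Qed.

Lemma gt_sorted_eq_int (s1 s2 : seq int) :
  sorted >%R s1 -> sorted >%R s2 -> s1 =i s2 -> s1 = s2.
Proof. by apply: irr_sorted_eq; [apply: gt_int_trans | move=> x; rewrite /= ltxx]. Qed.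

(** The segment [s] is followed by the vacuum [z], [z - 1], and so on, which makes the charge
    [z + size s]. *)
Definition wcat (z : int) (s : seq int) : wedge :=
  fun i => if (i < size s)%N then nth 0 s i else z - (i - size s)%N%:Z.

Lemma set_pair_wcat z s1 t u s2 x y :
  set_pair (wcat z (s1 ++ t :: u :: s2)) (size s1) x y = wcat z (s1 ++ x :: y :: s2).
Proof.
apply/funext => j; rewrite /set_pair /wcat !size_cat /= !nth_cat.
have [->|] := eqVneq j (size s1).
  by rewrite ltnn subnn /= ifT //; lia.
have [->|h1 h2] := eqVneq j (size s1).+1.
  by rewrite (ltnNge _ (size s1)) leqnSn subSnn /= ifT //; lia.
case: ltnP => // h3; case: ltnP => // h4.
by have -> : (j - size s1)%N = (j - size s1 - 2).+2 by lia.
Qed.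

Lemma not_sortedP (s : seq int) : ~~ sorted >%R s ->
  exists s1 t u s2, s = s1 ++ t :: u :: s2 /\ t <= u.
Proof.
elim: s => //= x [|y s] //= IH; rewrite negb_and; case: ltP => //= h.
  by move=> /IH [s1 [t [u [s2 [-> htu]]]]]; exists (x :: s1), t, u, s2.
by move=> _; exists [::], x, y, s.
Qed.

(** A termination measure: distances to the upper bound [B], weighted more heavily the further left
    an entry stands. *)
Fixpoint depth (B : int) (s : seq int) : nat :=
  if s is x :: s' then ((size s').+1 * `|B - x| + depth B s')%N else 0%N.

Lemma depth_cat B s1 s2 s3 : size s2 = size s3 -> (depth B s2 < depth B s3)%N ->
  (depth B (s1 ++ s2) < depth B (s1 ++ s3))%N.
Proof. by move=> hs h; elim: s1 => //= x s1 IH; rewrite !size_cat hs ltn_add2l. Qed.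

(** Straightening terminates, since exchanges keep the entries below a fixed bound and lower
    [depth]. For [t = u] there is no exchange, so the second premise must then give [G] outright. *)
Lemma exchange_ind e r (G : seq int -> Prop) :
  (forall s, sorted >%R s -> G s) ->
  (forall s1 (t u : int) s2, t <= u ->
     (forall x, exchange e r t u x -> G (s1 ++ (u - x) :: (t + x) :: s2)) ->
     G (s1 ++ t :: u :: s2)) ->
  forall s, G s.
Proof.
move=> G_sorted G_step s.
have [B hB] : exists B, all (fun x => x <= B) s.
  elim: s => [|x s [B hB]]; first by exists 0.
  exists (Order.max x B); rewrite /= le_max lexx /=.
  by apply: sub_all hB => y; rewrite le_max orbC => ->.
have [k] := ubnP (depth B s); elim: k => // k IH in s hB *; rewrite ltnS => hk.
have [|/not_sortedP [s1 [t [u [s2 [hs htu]]]]]] := boolP (sorted >%R s).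
  exact: G_sorted.
rewrite hs; apply: G_step => // x [x_ge0 hx _ _ _]; apply: IH.
  by move: hB; rewrite hs !all_cat /= => /and4P[-> h1 h2 ->]; lia.
apply: leq_trans hk; rewrite hs; apply: depth_cat => //=.
move: hB; rewrite hs all_cat /= => /and4P[_ h1 h2 _].
(* The two entries keep their sum and the left one weighs one unit more, so the measure drops by
   [u - x - t], which is positive. *)
by nia.
Qed.

Section Wedges.
Variables (e r : nat) (c z : int).
Hypotheses (e_gt0 : (0 < e)%N) (r_gt0 : (0 < r)%N).

Local Notation W s := (<< wcat z s >> : {malg Qq[wedge]}).
Local Notation "x ≡ y" := (wedge_eq e r c x y) (at level 70).

Lemma wcat_straighten s1 (t u : int) s2 :
  c = z + (size (s1 ++ t :: u :: s2))%:Z -> t <= u ->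
  W (s1 ++ t :: u :: s2) ≡
  straighten e r t u (fun x => W (s1 ++ (u - x) :: (t + x) :: s2)).
Proof.
move=> hc htu; pose w := wcat z (s1 ++ t :: u :: s2).
have hw1 : w (size s1) = t.
  by rewrite /w /wcat size_cat nth_cat /= ltnn subnn ifT //; lia.
have hw2 : w (size s1).+1 = u.
  by rewrite /w /wcat size_cat nth_cat /= (ltnNge _ (size s1)) leqnSn subSnn ifT //; lia.
have hw : has_charge c w.
  exists (size (s1 ++ t :: u :: s2)) => i hi.
  by rewrite /w /wcat ltnNge hi hc /=; lia.
have : relators_span e r c (1 *: relator e r w (size s1) + 0).
  by apply: relators_spanD => //; [rewrite hw1 hw2 | constructor].
rewrite scale1r addr0 /wedge_eq /relator hw1 hw2.
by under [X in straighten _ _ _ _ X]eq_fun do rewrite set_pair_wcat.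
Qed.

Lemma two_neq0 : (2%:R : Qq) != 0.
Proof. by rewrite -(rmorph_nat (@tofrac _)) tofrac_eq0 -polyC_natr polyC_eq0. Qed.

Lemma alphatt t : alpha e r t t = 0. Proof. by rewrite /alpha subrr mod0z. Qed.
Lemma betatt t : beta e r t t = 0. Proof. by rewrite /beta subrr mulr0 mod0z. Qed.

Lemma straightentt (V : lmodType Qq) t (F : int -> V) : straighten e r t t F = - F 0.
Proof. by rewrite /straighten alphatt betatt eqxx. Qed.

(** The relation reads w = -w here, and 2 is invertible in Q(q). *)
Lemma wcat_diag s1 (t : int) s2 : c = z + (size (s1 ++ t :: t :: s2))%:Z ->
  W (s1 ++ t :: t :: s2) ≡ 0.
Proof.
move=> hc; have := wcat_straighten hc (lexx t).
rewrite straightentt subr0 ?addr0.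
rewrite /wedge_eq opprK subr0 => /(relators_span_scale 2^-1).
by rewrite -mulr2n -scaler_nat scalerA mulVf ?scale1r // two_neq0.
Qed.

Lemma wcat_swap s1 (t u : int) s2 :
  c = z + (size (s1 ++ t :: u :: s2))%:Z -> t < u ->
  (forall x, 0 < x -> exchange e r t u x -> W (s1 ++ (u - x) :: (t + x) :: s2) ≡ 0) ->
  W (s1 ++ t :: u :: s2) ≡ - swap_coeff e r t u *: W (s1 ++ u :: t :: s2).
Proof.
move=> hc htu h0; apply: wedge_eq_trans (wcat_straighten hc (ltW htu)) _.
have := @straighten_closed e r e_gt0 r_gt0 _ (fun v => v ≡ 0) t u _
  (wedge_eq_refl _ _ _ _) _ _ h0.
rewrite subr0 addr0 /wedge_eq subr0 scaleNr opprK; apply.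
  by move=> x y; rewrite !subr0; apply: relators_span_add.
by move=> d x; rewrite !subr0; apply: relators_span_scale.
Qed.

(** The term [W 0] left aside by [straighten_closed] is itself an exchange when [t < u]; when
    [t = u] the wedge vanishes. *)
Lemma wcat_closed (P : {malg Qq[wedge]} -> Prop) s1 (t u : int) s2 :
  P 0 -> (forall x y, P x -> P y -> P (x + y)) -> (forall d x, P x -> P (d *: x)) ->
  (forall x y, x ≡ y -> P y -> P x) ->
  c = z + (size (s1 ++ t :: u :: s2))%:Z -> t <= u ->
  (forall x, exchange e r t u x -> P (W (s1 ++ (u - x) :: (t + x) :: s2))) ->
  P (W (s1 ++ t :: u :: s2)).
Proof.
move=> P0 PD PZ Peq hc; rewrite le_eqVlt => /predU1P [htu _|htu PW].
  by rewrite -htu in hc *; apply: Peq (wcat_diag hc) P0.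
apply: Peq (wcat_straighten hc (ltW htu)) _.
have h := @straighten_closed e r e_gt0 r_gt0 _ P t u _ P0 PD PZ (fun x _ => PW x).
rewrite -[straighten _ _ _ _ _](addrK
  (swap_coeff e r t u *: W (s1 ++ (u - 0) :: (t + 0) :: s2))).
apply: PD h _; rewrite -scaleNr; apply: PZ.
exact: PW (exchange0 e r htu).
Qed.

(* The entries coming from the first component of a multipartition. *)
Definition lead (t : int) : bool := wres_b e r t == 1.

Lemma exchange_lead t u x : exchange e r t u x ->
  (lead (u - x) + lead (t + x) = lead t + lead u)%N.
Proof.
by case=> _ _ _ /permP /(_ (pred1 1)) /=; rewrite /lead !addn0.
Qed.

(* A segment of a wedge cannot have more entries in the first component than
   there are candidates in the range of its entries: straightening the segment
   preserves that number, and makes the entries distinct. *)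
Lemma crowded_eq0 (lo hi : int) (B : seq int) :
  (forall y, lo <= y <= hi -> lead y -> y \in B) ->
  forall s2, all (fun y => lo <= y <= hi) s2 -> (size B < count lead s2)%N ->
  forall s1 s3, c = z + (size (s1 ++ s2 ++ s3))%:Z -> W (s1 ++ s2 ++ s3) ≡ 0.
Proof.
move=> hB; elim/(@exchange_ind e r) => [s hs hall|s' t u s htu IH hall] hcount s1 s3 hc.
  have : {subset filter lead s <= B}.
    move=> y; rewrite mem_filter => /andP[hy ys].
    by apply: hB => //; apply: (allP hall).
  move/uniq_leq_size; rewrite filter_uniq ?gt_sorted_uniq_int //.
  by rewrite size_filter leqNgt hcount => /(_ isT).
have hc' : c = z + (size ((s1 ++ s') ++ t :: u :: s ++ s3))%:Z.
  by rewrite hc !size_cat /= !size_cat /=; lia.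
rewrite -catA /= catA; apply: (wcat_closed (P := fun v => v ≡ 0)) => //.
- exact: wedge_eq_refl.
- by move=> x y hx hy; have := wedge_eqD hx hy; rewrite addr0.
- by move=> d x /(wedge_eqZ d); rewrite scaler0.
- by move=> x y; apply: wedge_eq_trans.
move=> x hx.
have -> : (s1 ++ s') ++ (u - x) :: (t + x) :: s ++ s3 =
  s1 ++ (s' ++ (u - x) :: (t + x) :: s) ++ s3 by rewrite -!catA.
apply: (IH x hx).
- move: hall; rewrite !all_cat /=; case: hx => ? ? _ _ _ /and4P[-> h1 h2 ->].
  by lia.
- by move: hcount (exchange_lead hx); rewrite !count_cat /=; lia.
- by rewrite hc !size_cat /= ?size_cat.
Qed.

(** Straightening stays within the range and keeps all the entries in the first component. As many
    distinct such entries as there are places must fill [B] exactly, so [B] is the only ordered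
    outcome. *)
Lemma full_straighten (lo hi : int) (B : seq int) : sorted >%R B ->
  (forall y, lo <= y <= hi -> lead y -> y \in B) ->
  forall s, all (fun y => lo <= y <= hi) s -> all lead s -> size s = size B ->
  forall s3, c = z + (size (s ++ s3))%:Z ->
  exists k, W (s ++ s3) ≡ k *: W (B ++ s3).
Proof.
move=> B_sorted hB; elim/(@exchange_ind e r)
  => [s hs hall hlead hsize|s' t u s htu IH hall hlead hsize] s3 hc.
  exists 1; rewrite scale1r.
  have s_uniq := gt_sorted_uniq_int hs.
  have hsub : {subset s <= B}.
    by move=> y ys; apply: hB; [apply: (allP hall) | apply: (allP hlead)].
  have hmem := uniq_min_size s_uniq hsub; rewrite hsize leqnn in hmem.
  have -> : s = B; last exact: wedge_eq_refl.
  by apply: gt_sorted_eq_int => //; have [] := hmem isT.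
have hc' : c = z + (size (s' ++ t :: u :: s ++ s3))%:Z by rewrite hc -catA.
rewrite -catA /=; apply: (wcat_closed (P := fun v => exists k, v ≡ k *: W (B ++ s3))) => //.
- by exists 0; rewrite scale0r; apply: wedge_eq_refl.
- by move=> x y [k hk] [l hl]; exists (k + l); rewrite scalerDl; apply: wedge_eqD.
- by move=> d x [k hk]; exists (d * k); rewrite -scalerA; apply: wedge_eqZ.
- by move=> x y hxy [k hk]; exists k; apply: wedge_eq_trans hk.
move=> x hx.
have -> : s' ++ (u - x) :: (t + x) :: s ++ s3 =
  (s' ++ (u - x) :: (t + x) :: s) ++ s3 by rewrite -catA.
apply: (IH x hx).
- move: hall; rewrite !all_cat /=; case: hx => ? ? _ _ _ /and4P[-> h1 h2 ->].
  by lia.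
- move: hlead (exchange_lead hx); rewrite !all_cat /=.
  by case: (lead t) (lead u) (lead (u - x)) (lead (t + x)) => [] [] [] []; rewrite ?andbF.
- by rewrite -hsize !size_cat.
- by rewrite hc !size_cat /= ?size_cat.
Qed.

End Wedges.

(** * Collecting the entries of the first component *)

Lemma gt_sorted_rcons_int (s : seq int) p :
  sorted >%R (rcons s p) = sorted >%R s && all (> p) s.
Proof. by rewrite !(sorted_pairwise gt_int_trans) pairwise_rcons andbC. Qed.

Lemma lt_sorted_rcons_int (s : seq int) p :
  sorted <%R (rcons s p) = sorted <%R s && all (< p) s.
Proof. by rewrite !lt_sorted_pairwise pairwise_rcons andbC. Qed.

Section Commutation.
Variables (e r : nat) (c z : int).
Hypotheses (e_gt0 : (0 < e)%N) (r_gt0 : (0 < r)%N).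

Local Notation W s := (<< wcat z s >> : {malg Qq[wedge]}).
Local Notation "x ≡ y" := (wedge_eq e r c x y) (at level 70).
Local Notation lead := (lead e r).

Definition insert (t : int) (D : seq int) : seq int :=
  [seq p <- D | t < p] ++ t :: [seq p <- D | p < t].

Lemma mem_insert t D : t \notin D -> insert t D =i t :: D.
Proof.
move=> tD y; rewrite /insert mem_cat !inE !mem_filter.
have [-> //|hy] := eqVneq y t; first by rewrite orbT.
by case: ltgtP hy; rewrite ?orbF ?eqxx.
Qed.

Lemma insert_sorted t D : sorted >%R D -> sorted >%R (insert t D).
Proof.
rewrite !(sorted_pairwise gt_int_trans) /insert pairwise_cat /= => hD.
rewrite !pairwise_filter // !andbT; apply/and3P; split.
- apply/allrelP => x y; rewrite mem_filter inE mem_filter => /andP[hx _].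
  by case/predU1P => [->|/andP[hy _]] //=; apply: lt_trans hx.
- done.
- by apply/allP => x; rewrite mem_filter => /andP[].
Qed.

(** [t] moves left past each smaller [p], by a pure swap. In any other exchange both new entries
    exceed [p], so the place [p] is lost while the number of [lead] entries is kept: the segment is
    too crowded and the term vanishes. *)
Lemma wcat_insert (hi t : int) (D : seq int) : sorted >%R D -> t \notin D ->
  ~~ lead t -> t <= hi -> all (fun p => p <= hi) D ->
  {in D, forall p, p < t -> lead p} ->
  (forall p y, p \in D -> lead p -> lead y -> p < y <= hi -> y \in D) ->
  forall rest, c = z + (size (D ++ t :: rest))%:Z ->
  W (D ++ t :: rest) ≡
  (\prod_(p <- D | p < t) - swap_coeff e r p t) *: W (insert t D ++ rest).
Proof.
move=> hs tD ht thi; elim/last_ind: D hs tD => [_ _ _ _ _ rest hc|D p IH].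
  by rewrite big_nil scale1r; apply: wedge_eq_refl.
rewrite gt_sorted_rcons_int => /andP[hs hDp]; rewrite mem_rcons inE negb_or.
move=> /andP[tp tD]; rewrite all_rcons => /andP[phi Dhi] Dlead Dfull rest.
rewrite /insert !filter_rcons -!cats1 big_cat big_cons big_nil /=.
have [ptlt|] := ltP p t; last first.
  rewrite le_eqVlt (negPf tp) /= => tplt hc.
  rewrite tplt big1_seq ?mulr1 ?scale1r => [|y /andP[h /(allP hDp) /=]]; last by lia.
  suff [-> ->] : [seq y <- D | t < y] = D /\ [seq y <- D | y < t] = [::].
    by rewrite -!catA; apply: wedge_eq_refl.
  split; [apply/all_filterP | apply/eqP; rewrite -[_ == _]negbK -has_filter];
    first by apply: sub_all hDp => y /=; apply: lt_trans.
  by apply/hasPn => y /(allP hDp) /=; lia.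
rewrite -catA /= => hc; rewrite ltNge (ltW ptlt) /= mulr1 mulrC.
have lead_p : lead p by apply: Dlead => //; rewrite mem_rcons mem_head.
have hD y : y \in D -> y \in rcons D p by rewrite mem_rcons inE orbC => ->.
apply: wedge_eq_transr.
  apply: (wcat_swap e_gt0 r_gt0) => // x x_gt0 hx.
  have h : D ++ t - x :: p + x :: rest = [::] ++ (D ++ [:: t - x; p + x]) ++ rest.
    by rewrite -catA.
  rewrite h; apply: (crowded_eq0 e_gt0 r_gt0 (lo := p + 1) (hi := hi)
    (B := filter lead D)).
  - move=> y hy lead_y; rewrite mem_filter lead_y /=.
    have : y \in rcons D p by apply: (Dfull p); rewrite ?mem_rcons ?mem_head //; lia.
    by rewrite mem_rcons inE => /predU1P [y_p|//]; lia.
  - rewrite all_cat /=; case: hx => _ hx _ _ _; apply/and3P; split; try lia.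
    apply/allP => y yD; have /= := allP hDp y yD; have /= := allP Dhi y yD; lia.
  - by rewrite count_cat size_filter /= addn0 (exchange_lead hx) lead_p (negPf ht) addn1 ltnSn.
  - by rewrite hc !size_cat /=; lia.
have hcat : (insert t D ++ p :: rest) =
  ([seq y <- D | t < y] ++ t :: [seq y <- D | y < t] ++ [:: p]) ++ rest.
  by rewrite /insert -!catA /= -catA.
rewrite -hcat; apply: IH => //.
- by move=> y yD; apply: Dlead; apply: hD.
- move=> p' y p'D lead_p' lead_y hy.
  have : y \in rcons D p by apply: (Dfull p') => //; apply: hD.
  rewrite mem_rcons inE => /predU1P [y_p|//].
  by have /= := allP hDp p' p'D; lia.
- by rewrite hc !size_cat.
Qed.

Lemma wcat_merge (hi : int) (s D E : seq int) : sorted >%R D -> sorted >%R s ->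
  sorted >%R E -> E =i D ++ s ->
  {in s, forall t, [/\ t \notin D, ~~ lead t & t <= hi]} ->
  all (fun p => p <= hi) D ->
  {in D & s, forall p t, p < t -> lead p} ->
  (forall p y, p \in D -> lead p -> lead y -> p < y <= hi -> y \in D) ->
  c = z + (size (D ++ s))%:Z ->
  W (D ++ s) ≡
  (\prod_(t <- s) \prod_(p <- D | p < t) - swap_coeff e r p t) *: W E.
Proof.
move=> + + hE; elim: s D => [|t s IH] D hD hs memE sP Dhi Dlead Dfull hc.
  rewrite big_nil scale1r cats0.
  rewrite (_ : E = D); first exact: wedge_eq_refl.
  by apply: gt_sorted_eq_int => // y; rewrite memE cats0.
have [tD ht thi] := sP t (mem_head _ _).
have st : all (fun y => y < t) s by apply: order_path_min hs; apply: gt_int_trans.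
rewrite big_cons; apply: wedge_eq_transr.
  apply: (wcat_insert (hi := hi)) => //.
  by move=> p pD; apply: Dlead; rewrite ?mem_head.
have hmem := mem_insert tD.
(* The inserted [t] exceeds every later entry of [s], so it is not among the entries those will have
   to pass. *)
have -> : \prod_(t0 <- s) \prod_(p <- D | p < t0) - swap_coeff e r p t0 =
    \prod_(t0 <- s) \prod_(p <- insert t D | p < t0) - swap_coeff e r p t0.
  apply: eq_big_seq => y ys; have /= yt := allP st y ys.
  rewrite /insert big_cat big_cons /= (_ : (t < y) = false); last by lia.
  rewrite !big_filter_cond /= [X in _ = X * _]big1 ?mul1r => [|p]; last by lia.
  by apply: eq_bigl => p; lia.
apply: IH.
- exact: insert_sorted.
- exact: path_sorted hs.
- by move=> y; rewrite memE mem_cat [RHS]mem_cat hmem !inE orbCA orbA.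
- move=> y ys; have /= yt := allP st y ys.
  have [h1 h2 h3] := sP y (@mem_behead _ (t :: s) _ ys).
  by split=> //; rewrite hmem inE negb_or h1 andbT; lia.
- by apply/allP => y; rewrite hmem inE => /predU1P [->//|]; apply: (allP Dhi).
- move=> p y; rewrite hmem inE => /predU1P [->|pD] ys; have /= := allP st y ys; first by lia.
  by move=> _; apply: Dlead; rewrite ?inE ?ys ?orbT.
- move=> p y; rewrite hmem [in X in _ -> _ -> _ -> _ -> X]hmem !inE.
  move=> /predU1P [->|pD lead_p lead_y hy]; first by rewrite (negPf ht).
  by rewrite (Dfull p y) ?orbT.
- rewrite hc !size_cat /= !size_filter.
  have : (size D = count (> t)%R D + count (< t)%R D)%N.
    rewrite -[LHS](count_predC (> t)); congr addn.
    by apply: eq_in_count => y yD /=; case: ltgtP => // hy; rewrite hy yD in tD.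
  by move=> ->; rewrite !addnS addSn.
Qed.

(** This is for reversed wedges, where [p] exceeds everything on its left. An exchange with [x > 0]
    would leave [size D + 1] entries of the first component between [lo] and [p - 1], where only [D]
    has room for them. *)
Lemma wcat_move_lead (lo p : int) (D F : seq int) : lead p -> lo <= p ->
  all lead D -> all (fun y => lo <= y < p) D -> all (fun y => lo <= y < p) F ->
  all (predC lead) F -> (forall y, lead y -> lo <= y < p -> y \in D) ->
  forall rest, c = z + (size (D ++ F ++ p :: rest))%:Z ->
  exists k, W (D ++ F ++ p :: rest) ≡ k *: W (D ++ p :: F ++ rest).
Proof.
move=> lead_p lop D_lead hD hF Fnl Dfull.
elim/last_ind: F hF Fnl => [_ _ rest hc|F t IH].
  by exists 1; rewrite scale1r; apply: wedge_eq_refl.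
rewrite !all_rcons => /andP[ht hF] /andP[/= t_nl Fnl] rest hc; rewrite -!cats1 -!catA /=.
have hc' : c = z + (size ((D ++ F) ++ t :: p :: rest))%:Z.
  by rewrite hc -cats1 !size_cat /= ?size_cat /=; lia.
have [|k hk] := IH hF Fnl (t :: rest); first by rewrite hc' !size_cat /=; lia.
exists (- swap_coeff e r t p * k).
apply: wedge_eq_transr hk; rewrite !catA.
apply: (wcat_swap e_gt0 r_gt0) => //; first by case/andP: ht.
move=> x x_gt0 hx.
have -> : (D ++ F) ++ p - x :: t + x :: rest =
  [::] ++ ((D ++ F) ++ [:: p - x; t + x]) ++ rest by rewrite -!catA.
apply: (crowded_eq0 e_gt0 r_gt0 (lo := lo) (hi := p - 1) (B := D)).
- by move=> y hy lead_y; apply: Dfull => //; lia.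
- rewrite !all_cat /=; case: hx => _ hx _ _ _; apply/and3P; split; last by lia.
    by apply/andP; split; [apply: sub_all hD | apply: sub_all hF] => y; lia.
  by lia.
- rewrite !count_cat /= addn0 (exchange_lead hx) lead_p (negPf t_nl).
  by move: D_lead; rewrite all_count => /eqP ->; lia.
- by rewrite hc' !size_cat /=; lia.
Qed.

(** Each new largest entry stays in place or, if [lead], moves left past the others. The scalar is
    left unspecified because it will cancel in the quotient of coefficients. *)
Lemma wcat_unshuffle (lo : int) (E : seq int) : sorted <%R E -> all (>= lo) E ->
  (forall p y, p \in E -> lead p -> lead y -> lo <= y < p -> y \in E) ->
  forall rest, c = z + (size (E ++ rest))%:Z ->
  exists k, W (E ++ rest) ≡
    k *: W ([seq y <- E | lead y] ++ [seq y <- E | ~~ lead y] ++ rest).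
Proof.
elim/last_ind: E => [_ _ _ rest _|E p IH].
  by exists 1; rewrite scale1r; apply: wedge_eq_refl.
rewrite lt_sorted_rcons_int all_rcons => /andP[hE hEp] /andP[lop Elo] Efull rest hc.
have [||k hk] := IH hE Elo _ (p :: rest).
- move=> p' y p'E lead_p' lead_y hy.
  have : y \in rcons E p by apply: (Efull p') => //; rewrite mem_rcons inE p'E orbT.
  rewrite mem_rcons inE => /predU1P [y_p|//].
  by have /= := allP hEp p' p'E; lia.
- by rewrite hc -cats1 -catA.
rewrite !filter_rcons cat_rcons.
case: ifP => lead_p /=; last by exists k; rewrite cat_rcons.
have hE' y : y \in E -> lo <= y < p.
  by move=> yE; have /= := allP hEp y yE; have /= := allP Elo y yE; lia.
have [||||||l hl] := @wcat_move_lead lo p [seq y <- E | lead y]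
  [seq y <- E | ~~ lead y] lead_p lop _ _ _ _ _ rest; last first.
- by exists (k * l); rewrite cat_rcons; apply: wedge_eq_transr hk hl.
- have hsz : size E = (size [seq y <- E | lead y] + size [seq y <- E | ~~ lead y])%N.
    by rewrite !size_filter -(count_predC lead E).
  by rewrite hc -cats1 !size_cat hsz /=; lia.
- move=> y lead_y hy; rewrite mem_filter lead_y /=.
  have : y \in rcons E p by apply: (Efull p) => //; rewrite mem_rcons mem_head.
  by rewrite mem_rcons inE => /predU1P [y_p|//]; lia.
- exact: filter_all.
- by apply/allP => y; rewrite mem_filter => /andP[_ /hE'].
- by apply/allP => y; rewrite mem_filter => /andP[_ /hE'].
- exact: filter_all.
Qed.

End Commutation.

(** * Multipartitions and ordered wedges *)

(* The beta-number [x] of component [k] (numbered from 0) as a wedge entry. *)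
Definition entry (e r k : nat) (x : int) : int :=
  wres_a e x + (e * k)%N%:Z - (e * r)%N%:Z * wres_m e 1 x.

Lemma entry_pt e r k x : (0 < e)%N -> exists a n : int,
  [/\ 0 <= a < e%:Z, x = pt e 1 a 0 n & entry e r k x = pt e r a k n].
Proof.
move=> e_gt0; have [a [b [n [ha hb ->]]]] := ptP e_gt0 (ltn0Sn 0) x.
exists a, n; have -> : b = 0 by lia.
have h0 : (0 : int) <= 0 < 1%:Z by lia.
split=> //; rewrite /entry; have [-> _ ->] := wres_pt e_gt0 (ltn0Sn 0) n ha h0.
by rewrite /pt; lia.
Qed.

Section Entries.
Variables e r : nat.
Hypotheses (e_gt0 : (0 < e)%N) (r_gt0 : (0 < r)%N).

Lemma entry_lt (k : nat) x y : (k < r)%N -> (entry e r k x < entry e r k y) = (x < y).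
Proof.
move=> hk; have [a [n [ha -> ->]]] := entry_pt r k x e_gt0.
have [a' [n' [ha' -> ->]]] := entry_pt r k y e_gt0.
by rewrite !pt_lt // ?ltxx ?eqxx; lia.
Qed.

Lemma wres_b_entry (k : nat) x : (k < r)%N -> wres_b e r (entry e r k x) = k%:Z + 1.
Proof.
move=> hk; have [a [n [ha _ ->]]] := entry_pt r k x e_gt0.
by have [] := wres_pt e_gt0 r_gt0 n ha (_ : 0 <= k%:Z < r%:Z).
Qed.

(** Both inequalities say that the coordinate [n] of [x] is at least [n0]; thus one threshold cuts
    all the components at the same beta-number. *)
Lemma entry_gt (k : nat) x n0 : (k < r)%N ->
  ((e * r)%N%:Z * n0 < entry e r k x) = (e%:Z * n0 < x).
Proof.
move=> hk; have [a [n [ha -> ->]]] := entry_pt r k x e_gt0; rewrite /pt.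
have ek_ge0 : 0 <= e%:Z * k%:Z by [].
have [h|h] := lerP n0 n.
  have h1 : e%:Z * n0 <= e%:Z * n by rewrite ler_wpM2l.
  have h2 : (e * r)%N%:Z * n0 <= (e * r)%N%:Z * n by rewrite ler_wpM2l.
  by lia.
have h1 : e%:Z * (n + 1) <= e%:Z * n0 by rewrite ler_wpM2l // lezD1.
have h2 : (e * r)%N%:Z * (n + 1) <= (e * r)%N%:Z * n0 by rewrite ler_wpM2l // lezD1.
have h3 : e%:Z * (k%:Z + 1) <= e%:Z * r%:Z by rewrite ler_wpM2l // lezD1.
by lia.
Qed.

Lemma entryP t : exists (k : 'I_r) x, t = entry e r k x.
Proof.
have [a [b [n [ha hb ->]]]] := ptP e_gt0 r_gt0 t.
have hk : (`|b| < r)%N by lia.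
exists (Ordinal hk), (pt e 1 a 0 n); rewrite /entry.
have h0 : (0 : int) <= 0 < 1%:Z by lia.
by have [-> _ ->] := wres_pt e_gt0 (ltn0Sn 0) n ha h0; rewrite /pt /=; nia.
Qed.

Lemma wres_m_le t n0 : (e * r)%N%:Z * n0 < t -> wres_m e r t <= - n0.
Proof.
have [a [b [n [ha hb ->]]]] := ptP e_gt0 r_gt0 t.
have [_ _ ->] := wres_pt e_gt0 r_gt0 n ha hb; rewrite lerN2 => h.
rewrite leNgt; apply/negP => hn; move: h; rewrite /pt.
have h1 : e%:Z * (b + 1) <= e%:Z * r%:Z by rewrite ler_wpM2l //; lia.
have h2 : (e * r)%N%:Z * (n + 1) <= (e * r)%N%:Z * n0 by rewrite ler_wpM2l //; lia.
by lia.
Qed.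

Lemma entry_component (k k' : nat) x x' : (k < r)%N -> (k' < r)%N ->
  entry e r k x = entry e r k' x' -> k = k'.
Proof.
by move=> hk hk' /(congr1 (wres_b e r)); rewrite !wres_b_entry //; lia.
Qed.

End Entries.

Lemma level_up_entry e r (k : nat) x : (0 < e)%N -> (k < r)%N ->
  level_up e r (entry e r k x) = entry e r.+1 k.+1 x.
Proof.
move=> e_gt0 hk; have r_gt0 := leq_ltn_trans (leq0n _) hk.
rewrite /entry; have [a [b [n [ha hb ->]]]] := ptP e_gt0 (ltn0Sn 0) x.
have [-> _ ->] := wres_pt e_gt0 (ltn0Sn 0) n ha hb.
have -> : a + 1 + (e * k)%N%:Z - (e * r)%N%:Z * - n = pt e r a k n by rewrite /pt; lia.
by rewrite level_up_pt //; rewrite /pt; lia.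
Qed.

Lemma part_nonincr (p : intpart) i j : (i <= j)%N -> (part p j <= part p i)%N.
Proof.
case: p => p p_ok hij; case/andP: (p_ok) => hp _; rewrite /part /=.
have [hj|hj] := ltnP j (size p); last by rewrite nth_default.
have := @sorted_leq_nth _ geq _ _ 0%N p hp i j; apply=> //.
- by move=> y x z /= h1 h2; apply: leq_trans h2 h1.
- by move=> x /=.
- by rewrite inE (leq_ltn_trans hij).
Qed.

Lemma part_default (p : intpart) i : (size (sval p) <= i)%N -> part p i = 0%N.
Proof. exact: nth_default. Qed.

(** Subtracting the staircase [m + size xs - i] from a strictly decreasing sequence above [m] leaves
    a weakly decreasing sequence of non-negative integers. *)
Lemma partition_of_betas (m : int) (xs : seq int) : sorted >%R xs -> all (> m) xs ->
  exists p : intpart, (size (sval p) <= size xs)%N /\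
    forall i, (i < size xs)%N ->
      (part p i)%:Z = nth 0 xs i - (m + (size xs)%:Z) + i%:Z.
Proof.
elim: xs => [_ _|x xs IH hx]; first by exists (exist _ [::] isT).
move=> /= /andP[mx hall]; have [p [hsize hp]] := IH (path_sorted hx) hall.
have h0 : (part p 0)%:Z <= x - (m + (size xs).+1%:Z).
  case: xs hsize hp hx {IH hall} => [|y xs] hsize hp.
    by rewrite part_default //= => _; lia.
  by rewrite hp //= => /andP[] /=; lia.
set d := `|(x - (m + (size xs).+1%:Z))%R|%N.
have hd : d%:Z = x - (m + (size xs).+1%:Z) by lia.
(* If the first part is 0, so are all the others, and the list must be empty because an [intpart]
   contains no zero. *)
have [d0|d_neq0] := eqVneq d 0%N.
  exists (exist _ [::] isT); split=> // -[_|i hi]; first by rewrite /= /part /=; lia.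
  have h1 := hp i hi; have h2 := part_nonincr p (leq0n i).
  have h3 : (part p i)%:Z = 0 by lia.
  by move: h1; rewrite h3 /part nth_nil /=; set y := nth _ _ _; lia.
have hq : sorted geq (d :: sval p) && (0%N \notin d :: sval p).
  case: p {hp hsize} h0 => -[|y p] /= hp h0; first by rewrite inE eq_sym d_neq0.
  by rewrite inE eq_sym negb_or d_neq0 andbA; move: h0; rewrite /part /= => h0;
    case/andP: hp => -> ->; lia.
exists (exist _ (d :: sval p) hq); split=> // -[_|i hi] /=.
  by rewrite /part /=; lia.
by have := hp i hi; rewrite /part /=; lia.
Qed.

Section Kets.
Variables e r : nat.
Hypotheses (e_gt0 : (0 < e)%N) (r_gt0 : (0 < r)%N).
Implicit Types (lam : multipartition r) (st : r.-tuple int).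

Lemma beta_number_lt lam st k i j : (i < j)%N ->
  beta_number lam st k j < beta_number lam st k i.
Proof. by move=> h; have := part_nonincr (tnth lam k) (ltnW h); rewrite /beta_number; lia. Qed.

Lemma beta_check_lt lam st k i j : (i < j)%N ->
  beta_check e lam st k j < beta_check e lam st k i.
Proof. by move=> h; rewrite [_ < _]entry_lt // beta_number_lt. Qed.

Lemma beta_check_inj lam st k i k' i' :
  beta_check e lam st k i = beta_check e lam st k' i' -> k = k' /\ i = i'.
Proof.
move=> h; have hk : k = k'.
  by apply: val_inj; apply: (entry_component e_gt0 r_gt0 _ _ h).
split=> //; subst k'; case: (ltngtP i i') => // hi;
  by have := beta_check_lt lam st k hi; rewrite h ltxx.
Qed.

(** [ket] reads its entry [n] off a sorted finite sample. The sample contains [w 0], ..., [w n], and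
    these are its largest elements, so its sorted list begins with them. *)
Lemma ket_unique lam st (w : wedge) :
  (forall i j, (i < j)%N -> w j < w i) ->
  (forall n, exists k i, w n = beta_check e lam st k i) ->
  (forall k i, exists n, w n = beta_check e lam st k i) ->
  w = ket e st lam.
Proof.
move=> w_lt w_in w_all; apply/funext => n; rewrite /ket.
set l := (X in sort _ X).
have w_le i j : (w j <= w i) = (i <= j)%N.
  by case: (ltngtP i j) => [/w_lt/ltW//|/w_lt|->]; rewrite ?lexx // leNgt => ->.
have l_uniq : uniq l.
  apply: allpairs_uniq; rewrite ?enum_uniq ?iota_uniq // => -[k i] [k' i'] _ _ /=.
  by case/beta_check_inj => -> ->.
have w_l j : (j <= n)%N -> w j \in l.
  move=> hj; have [k [i wE]] := w_in j; rewrite wE.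
  apply/allpairsPdep; exists k, i; rewrite mem_enum mem_iota ltnS; split=> //=.
  (* [g i] is the position in [w] of the entry of index [i] in component [k]. It increases strictly
     with [i], hence [i <= g i], and so the index of [w j] is at most [n]. *)
  have [g hg] := choice (w_all k).
  have g_lt : {homo g : x y / (x < y)%N}.
    move=> x y hxy; rewrite ltnNge -w_le !hg -ltNge.
    exact: beta_check_lt.
  have hgi i' : (i' <= g i')%N.
    by elim: i' => // i' IH; apply: leq_ltn_trans IH _; apply: g_lt.
  apply: leq_trans (hgi i) _; apply: leq_trans hj.
  by rewrite -w_le hg wE.
have -> : sort >=%R l = [seq w j | j <- iota 0 n.+1] ++
    sort >=%R [seq t <- l | t < w n].
  have ge_tr : transitive (>=%R : rel int) by move=> y x z /= h1 h2; apply: le_trans h2 h1.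
  have ge_tot : total (>=%R : rel int) by move=> x y; apply: le_total.
  apply: (sorted_eq ge_tr) => [x y /= h|||]; first by apply/le_anti; rewrite andbC.
  - exact: sort_sorted.
  - rewrite (sorted_pairwise ge_tr) pairwise_cat -!(sorted_pairwise ge_tr).
    rewrite sort_sorted // andbT; apply/andP; split.
      apply/allrelP => x y /mapP [j]; rewrite mem_iota => /= hj ->.
      rewrite mem_sort mem_filter => /andP[hy _]; apply/ltW/(lt_le_trans hy).
      by rewrite w_le; lia.
    rewrite sorted_map; apply: sub_sorted (iota_ltn_sorted _ _) => x y /=.
    by move=> h; rewrite w_le ltnW.
  - rewrite perm_sort; apply: uniq_perm => //.
      rewrite cat_uniq sort_uniq filter_uniq // andbT map_inj_uniq ?iota_uniq //.
        apply/hasPn => x; rewrite mem_sort mem_filter => /andP[hx _].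
        apply/mapP => -[j]; rewrite mem_iota => /= hj x_w; move: hx.
        by rewrite x_w ltNge w_le; lia.
      by move=> i j hij; have := w_le i j; have := w_le j i; rewrite hij lexx; lia.
    move=> t; rewrite mem_cat mem_sort mem_filter.
    apply/idP/orP => [tl|[|/andP[]//]]; last first.
      by move=> /mapP [j]; rewrite mem_iota => /= hj ->; apply: w_l; lia.
    have [tn|] := ltP t (w n); [by right | move=> tn; left].
    have /allpairsPdep [k [i [_ _ tE]]] := tl; have [j hj] := w_all k i.
    rewrite tE -hj; apply: map_f; rewrite mem_iota /= add0n ltnS -w_le hj -tE //.
rewrite nth_cat size_map size_iota ltnSn (nth_map 0%N) ?size_iota //.
by rewrite nth_iota.
Qed.

(** In every component, the beta-numbers up to [e n0] then come from zero parts and exhaust the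
    integers up to [e n0]. *)
Definition deep st lam (n0 : int) : Prop :=
  forall k, (size (sval (tnth lam k)))%:Z <= tnth st k - e%:Z * n0.

Definition entries_above st lam (z : int) (s : seq int) : Prop :=
  forall t, t \in s <-> z < t /\ exists k i, t = beta_check e lam st k i.

Lemma ket_wcat st lam n0 s : deep st lam n0 -> sorted >%R s ->
  entries_above st lam ((e * r)%N%:Z * n0) s ->
  wcat ((e * r)%N%:Z * n0) s = ket e st lam.
Proof.
set z := (e * r)%N%:Z * n0 => hdeep hs hsE.
have s_gt i : (i < size s)%N -> z < nth 0 s i.
  by move=> hi; have [] := (hsE (nth 0 s i)).1 (mem_nth _ hi).
apply: ket_unique => [i j hij|n|k i].
- rewrite /wcat; case: (ltnP j) => hj; last first.
    by case: ltnP => hi; [have := s_gt i hi; lia | lia].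
  rewrite (ltn_trans hij) //.
  by apply: (sorted_ltn_nth gt_int_trans); rewrite ?inE // (ltn_trans hij).
- rewrite /wcat; case: ltnP => hn.
    by have [_] := (hsE (nth 0 s n)).1 (mem_nth _ hn).
  (* An integer at most [z] is the entry of some [x <= e n0], and [deep] makes [x] the beta-number
     of index [tnth st k - x], with zero part. *)
  have [k [x tE]] := entryP e_gt0 r_gt0 (z - (n - size s)%N%:Z).
  have hx : x <= e%:Z * n0.
    by rewrite leNgt -(entry_gt e_gt0 r_gt0 x n0 (ltn_ord k)) -tE -leNgt; lia.
  have := hdeep k; set m := size _ => hm.
  exists k, `|tnth st k - x|%N; rewrite tE; congr entry.
  rewrite /beta_number part_default; first by lia.
  by rewrite -/m; lia.
- have [ht|ht] := ltP z (beta_check e lam st k i).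
    have hin : beta_check e lam st k i \in s by apply/hsE; split=> //; exists k, i.
    by exists (index (beta_check e lam st k i) s); rewrite /wcat index_mem hin nth_index.
  exists (size s + `|z - beta_check e lam st k i|)%N; rewrite /wcat.
  by rewrite ltnNge leq_addr /=; lia.
Qed.

Lemma entry_above st lam n0 (k : 'I_r) i : deep st lam n0 ->
  ((e * r)%N%:Z * n0 < beta_check e lam st k i) = (i%:Z < tnth st k - e%:Z * n0).
Proof.
move=> hdeep; rewrite [LHS](entry_gt e_gt0 r_gt0) // /beta_number.
have := hdeep k; set m := size _ => hm.
have [hi|hi] := leqP m i; first by rewrite part_default //; lia.
by lia.
Qed.

Lemma entries_above_exists st lam n0 : deep st lam n0 ->
  exists2 s, sorted >%R s & entries_above st lam ((e * r)%N%:Z * n0) s.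
Proof.
move=> hdeep; pose K (k : 'I_r) := `|(tnth st k - e%:Z * n0)%R|%N.
pose l := undup [seq beta_check e lam st k i | k <- enum 'I_r, i <- iota 0 (K k)].
exists (sort >=%R l) => [|t].
  have : sorted >=%R (sort >=%R l) by apply: sort_sorted => x y; apply: le_total.
  have : uniq (sort >=%R l) by rewrite sort_uniq undup_uniq.
  move: (sort _ _) => s.
  have ge_tr : transitive (>=%R : rel int) by move=> y x z /= h1 h2; apply: le_trans h2 h1.
  rewrite uniq_pairwise (sorted_pairwise ge_tr) (sorted_pairwise gt_int_trans) => h1 h2.
  have : pairwise [rel x y | (x != y) && (y <= x)] s by rewrite pairwise_relI h1.
  by apply: sub_pairwise => x y /= /andP[]; rewrite lt_neqAle eq_sym => -> ->.
rewrite mem_sort mem_undup; split.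
  case/allpairsPdep => k [i [_]]; rewrite mem_iota => /= hi ->; split; last by exists k, i.
  by rewrite entry_above //; have := hdeep k; rewrite /K in hi; lia.
case=> hz [k [i tE]]; move: hz; rewrite tE entry_above // => hi.
by apply/allpairsPdep; exists k, i; rewrite mem_enum mem_iota /K; split=> //=; lia.
Qed.

(** Exactly the indices [i < tnth st k - e n0] pass the threshold, whatever the parts are. *)
Lemma count_component st lam n0 s (k : 'I_r) : deep st lam n0 -> uniq s ->
  entries_above st lam ((e * r)%N%:Z * n0) s ->
  (count (fun t => wres_b e r t == k%:Z + 1) s)%:Z = tnth st k - e%:Z * n0.
Proof.
move=> hdeep s_uniq sE; set K := tnth st k - _.
have K_ge0 : 0 <= K by apply: le_trans (hdeep k).
have -> : K = (size [seq beta_check e lam st k i | i <- iota 0 `|K|])%:Z.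
  by rewrite size_map size_iota; lia.
rewrite -size_filter; congr Posz; apply/perm_size/uniq_perm.
- exact: filter_uniq.
- rewrite map_inj_uniq ?iota_uniq // => i j /beta_check_inj; tauto.
move=> t; rewrite mem_filter; apply/andP/mapP => [[/eqP tk ts]|[i]].
  have [hz [k' [i tE]]] := (sE t).1 ts.
  have kk' : k' = k.
    apply: val_inj; move: tk; rewrite tE [beta_check _ _ _ _ _]/(entry e r k' _).
    by rewrite wres_b_entry // => /addIr [].
  exists i; last by rewrite tE kk'.
  rewrite mem_iota /=; move: hz.
  by rewrite tE kk' entry_above //; rewrite -/K; lia.
rewrite mem_iota /= => hi ->; split.
  by rewrite [beta_check _ _ _ _ _]/(entry e r k _) wres_b_entry.
by apply/sE; split; [rewrite entry_above //; rewrite -/K; lia | exists k, i].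
Qed.

Lemma size_components (s : seq int) :
  size s = (\sum_(k < r) count (fun t => wres_b e r t == k%:Z + 1)%R s)%N.
Proof.
elim: s => [|t s IH] /=; first by rewrite big1.
rewrite big_split /= -IH -[LHS]add1n; congr addn.
have [k [x ->]] := entryP e_gt0 r_gt0 t; rewrite wres_b_entry //.
rewrite (bigD1 k) //= eqxx big1 // => k' hk'.
by case: eqP => // /addIr [] h; rewrite (val_inj h) eqxx in hk'.
Qed.

Lemma charge_size st n0 s :
  (forall k : 'I_r, (count (fun t => wres_b e r t == k%:Z + 1) s)%:Z =
     tnth st k - e%:Z * n0) ->
  charge st = (e * r)%N%:Z * n0 + (size s)%:Z.
Proof.
move=> s_count; rewrite size_components /charge -[X in _ = _ + X]natz natr_sum.
under [X in _ = _ + X]eq_bigr do rewrite natz s_count.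
rewrite big_split /= sumr_const card_ord -mulr_natr natz addrCA -[LHS]addr0.
by congr (_ + _); lia.
Qed.

(** This recognises the ordered outcomes of straightening as kets. The prescribed counts make the
    staircase of each component start at [tnth st k], as its beta-numbers require. *)
Lemma multipartition_of_entries st n0 s : sorted >%R s ->
  all (> ((e * r)%N%:Z * n0)) s ->
  (forall k : 'I_r, (count (fun t => wres_b e r t == k%:Z + 1) s)%:Z =
     tnth st k - e%:Z * n0) ->
  exists lam, deep st lam n0 /\ entries_above st lam ((e * r)%N%:Z * n0) s.
Proof.
move=> hs s_gt s_count.
have hP (k : 'I_r) : exists p : intpart,
    (size (sval p))%:Z <= tnth st k - e%:Z * n0 /\
    (forall t, wres_b e r t = k%:Z + 1 -> t \in s <->
      (e * r)%N%:Z * n0 < t /\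
      exists i, t = entry e r k ((part p i)%:Z + tnth st k - i%:Z)).
  have [xs xsE] : exists xs, [seq t <- s | wres_b e r t == k%:Z + 1] = map (entry e r k) xs.
    elim: s {hs s_gt s_count} => [|t s [xs xsE]]; first by exists [::].
    rewrite /=; case: eqP => [tk|_]; last by exists xs.
    have [k' [x tE]] := entryP e_gt0 r_gt0 t; exists (x :: xs); rewrite /= -xsE tE.
    by move: tk; rewrite tE wres_b_entry // => /addIr [] ->.
  have hxs : sorted >%R xs.
    have := sorted_filter gt_int_trans (fun t => wres_b e r t == k%:Z + 1) hs.
    by rewrite xsE sorted_map; apply: sub_sorted => x y /=; rewrite entry_lt.
  have xs_gt : all (> (e%:Z * n0)) xs.
    apply/allP => x hx /=; rewrite -(entry_gt e_gt0 r_gt0 x n0 (ltn_ord k)).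
    have : entry e r k x \in map (entry e r k) xs by apply: map_f.
    by rewrite -xsE mem_filter => /andP[_ /(allP s_gt)].
  have xs_size : (size xs)%:Z = tnth st k - e%:Z * n0.
    by rewrite -s_count -size_filter xsE size_map.
  have [p [hp1 hp2]] := partition_of_betas hxs xs_gt.
  exists p; split; first by rewrite -xs_size lez_nat.
  move=> t tk; have -> : (t \in s) = (t \in map (entry e r k) xs).
    by rewrite -xsE mem_filter tk eqxx.
  have hE i : (i < size xs)%N -> (part p i)%:Z + tnth st k - i%:Z = nth 0 xs i.
    by move=> /hp2 ->; rewrite xs_size; lia.
  split=> [/mapP [x xs_x ->]|[ht [i tE]]].
    split; first by rewrite entry_gt //; apply: (allP xs_gt).
    by exists (index x xs); rewrite hE ?index_mem // nth_index.
  have hi : (i < size xs)%N.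
    rewrite ltnNge; apply/negP => hi; move: ht.
    rewrite tE (entry_gt e_gt0 r_gt0) // part_default; first by lia.
    exact: leq_trans hp1 hi.
  by rewrite tE hE // map_f // mem_nth.
have [f hf] := choice hP.
exists (mktuple f); split=> [k|t]; first by rewrite tnth_mktuple; have [] := hf k.
have [k [x tE]] := entryP e_gt0 r_gt0 t.
have tk : wres_b e r t = k%:Z + 1 by rewrite tE wres_b_entry.
have [_ /(_ t tk) ->] := hf k; split=> [[ht [i hi]]|[ht [k' [i hi]]]]; split=> //.
  by exists k, i; rewrite /beta_check /beta_number tnth_mktuple.
have kk' : k = k'.
  by apply: val_inj; apply: (entry_component e_gt0 r_gt0 (x := x) _ _ (etrans (esym tE) hi)).
by exists i; rewrite hi kk' /beta_check /beta_number tnth_mktuple.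
Qed.

End Kets.

(** * Linear combinations *)

Section Lincomb.
Variables (K : choiceType) (V : lmodType Qq) (f : K -> V).
Implicit Types D : {malg Qq[K]}.

(** The linear extension of [f] to the free module, in the form in which [is_expansion] writes
    it. *)
Definition lincomb (D : {malg Qq[K]}) : V := \sum_(k <- msupp D) D@_k *: f k.

Lemma lincombEw (d : {fset K}) D : (msupp D `<=` d)%fset ->
  lincomb D = \sum_(k <- d) D@_k *: f k.
Proof.
move=> le; rewrite /lincomb (big_fset_incl _ le) //= => x xd /mcoeff_outdom ->.
by rewrite scale0r.
Qed.

Lemma lincomb0 : lincomb 0 = 0.
Proof. by rewrite /lincomb msupp0 big_seq_fset0. Qed.

Lemma lincombU k : lincomb << k >> = f k.
Proof. by rewrite (lincombEw msuppU_le) big_seq_fset1 mcoeffUU scale1r. Qed.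

Lemma lincombD D D' : lincomb (D + D') = lincomb D + lincomb D'.
Proof.
rewrite (lincombEw (msuppD_le D D')) (lincombEw (fsubsetUl (msupp D) (msupp D'))).
rewrite (lincombEw (fsubsetUr (msupp D) (msupp D'))) -big_split /=.
by apply: eq_bigr => k _; rewrite mcoeffD scalerDl.
Qed.

Lemma lincombZ a D : lincomb (a *: D) = a *: lincomb D.
Proof.
rewrite (lincombEw (msuppZ_le a D)) /lincomb scaler_sumr.
by apply: eq_bigr => k _; rewrite mcoeffZ scalerA.
Qed.

End Lincomb.

Lemma lincomb_comp (K K' : choiceType) (V : lmodType Qq) (f : K' -> V) (h : K -> K')
    (D : {malg Qq[K]}) :
  lincomb f (lincomb (fun k => << h k >> : {malg Qq[K']}) D) = lincomb (f \o h) D.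
Proof.
rewrite {2}/lincomb [RHS]/lincomb.
elim: (enum_fset (msupp D)) => [|k l IH]; first by rewrite !big_nil lincomb0.
by rewrite !big_cons lincombD lincombZ lincombU IH.
Qed.

Lemma mcoeff_lincomb (K K' : choiceType) (h : K -> K') (D : {malg Qq[K]}) k' :
  (lincomb (fun k => << h k >> : {malg Qq[K']}) D)@_k' =
  \sum_(k <- msupp D) D@_k * (h k == k')%:R.
Proof.
rewrite /lincomb (raddf_sum (mcoeff k')).
by apply: eq_bigr => k _; rewrite /= mcoeffZ mcoeffU.
Qed.

Lemma mcoeff_lincomb_inj (K K' : choiceType) (h : K -> K') (D : {malg Qq[K]}) k :
  injective h -> (lincomb (fun k => << h k >> : {malg Qq[K']}) D)@_(h k) = D@_k.
Proof.
move=> h_inj; rewrite mcoeff_lincomb.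
have [kD|kD] := boolP (k \in msupp D); last first.
  rewrite (mcoeff_outdom kD) big1_seq // => k0 /= h0; rewrite (inj_eq h_inj).
  case: eqP => [k0k|_]; last by rewrite mulr0.
  by rewrite -k0k h0 in kD.
rewrite (big_fsetD1 k) //= eqxx mulr1 big1_seq ?addr0 // => k0 /=.
by rewrite !inE (inj_eq h_inj) => /andP[/negPf -> _]; rewrite mulr0.
Qed.

Lemma rev_prefix_wcat z s : rev_prefix (size s) (wcat z s) = wcat z (rev s).
Proof.
apply/funext => i; rewrite /rev_prefix /wcat size_rev.
case: ltnP => // hi; rewrite nth_rev //.
by have -> : (size s - i.+1 < size s)%N by lia.
Qed.

(** * Adding an empty first component *)

Section AddComponent.
Variables (e r : nat) (st : r.-tuple int) (st1 n0 : int).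
Hypotheses (e_gt0 : (0 < e)%N) (r_gt0 : (0 < r)%N) (st1_gt : e%:Z * n0 <= st1).

Local Notation up := (level_up e r).
Local Notation z := ((e * r)%N%:Z * n0).
Local Notation z' := ((e * r.+1)%N%:Z * n0).
Local Notation top := (entry e r.+1 0 st1).
Local Notation lead := (lead e r.+1).
Local Notation st' := [tuple of st1 :: st].

Definition add_empty (lam : multipartition r) : multipartition r.+1 :=
  [tuple of emptypart :: lam].

Lemma add_empty_inj : injective add_empty.
Proof. by move=> x y [] xy; apply: val_inj. Qed.

(* The entries of the empty first component that are larger than [z']. *)
Definition lead_block : seq int :=
  [seq entry e r.+1 0 (st1 - i%:Z) | i <- iota 0 `|(st1 - e%:Z * n0)%R|].

Lemma lead_up t : lead (up t) = false.
Proof.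
have [k [x ->]] := entryP e_gt0 r_gt0 t.
rewrite level_up_entry // /lead wres_b_entry ?ltnS //; apply/negbTE/eqP. by lia.
Qed.

Lemma leadP t : reflect (exists x, t = entry e r.+1 0 x) (lead t).
Proof.
apply: (iffP idP) => [|[x ->]]; last by rewrite /lead wres_b_entry.
have [k [x ->]] := entryP e_gt0 (ltn0Sn r) t; rewrite /lead wres_b_entry //.
by case: k => -[|k] hk /= h; [exists x | lia].
Qed.

Lemma lead_block_sorted : sorted >%R lead_block.
Proof.
rewrite /lead_block sorted_map; apply: sub_sorted (iota_ltn_sorted _ _) => x y /= hxy.
by rewrite entry_lt //; lia.
Qed.

Lemma mem_lead_block t : (t \in lead_block) = [&& lead t, z' < t & t <= top].
Proof.
apply/mapP/and3P => [[i]|[/leadP [x ->]]].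
  rewrite mem_iota /= => hi ->; rewrite leNgt entry_lt // entry_gt //.
  by split; [apply/leadP; eexists | lia | lia].
rewrite leNgt entry_lt // entry_gt // => h1 h2.
exists `|(st1 - x)%R|%N; last by congr entry; lia.
by rewrite mem_iota /=; lia.
Qed.

Lemma up_gt t : (z' < up t) = (z < t).
Proof.
have [k [x ->]] := entryP e_gt0 r_gt0 t.
by rewrite level_up_entry // !entry_gt ?ltnS.
Qed.

Lemma deep_add_empty lam : deep e st lam n0 -> deep e st' (add_empty lam) n0.
Proof.
move=> hdeep k; case: (unliftP ord0 k) => [j ->|->]; first by rewrite !tnthS.
by rewrite !tnth0 /=; lia.
Qed.

(** The empty component 0 contributes [lead_block], and component [k + 1] the image under [up] of
    component [k]. *)
Lemma entries_above_add_empty lam s s' : entries_above e st lam z s ->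
  entries_above e st' (add_empty lam) z' s' <-> s' =i lead_block ++ map up s.
Proof.
move=> hs.
suff key t : t \in lead_block ++ map up s <->
    z' < t /\ exists k i, t = beta_check e (add_empty lam) st' k i.
  split=> [hs' t|hs' t]; last by rewrite hs'.
  by apply/idP/idP => [/hs' /key|/key /hs'].
have h0 i : beta_check e (add_empty lam) st' ord0 i = entry e r.+1 0 (st1 - i%:Z).
  by rewrite /beta_check /beta_number !tnth0 /part nth_nil add0r.
have hS (k : 'I_r) i : beta_check e (add_empty lam) st' (lift ord0 k) i =
    up (beta_check e lam st k i).
  rewrite [RHS](level_up_entry _ e_gt0 (ltn_ord k)).
  by rewrite /beta_check /beta_number !tnthS.
rewrite mem_cat; split.
  case/orP => [|/mapP [y /hs [hy [k [i yE]]] ->]].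
    case/mapP => i hi tE; split; last by exists ord0, i; rewrite h0.
    have : t \in lead_block by rewrite tE; apply: map_f.
    by rewrite mem_lead_block => /and3P[].
  by rewrite up_gt; split=> //; exists (lift ord0 k), i; rewrite hS yE.
case=> ht [k [i]]; case: (unliftP ord0 k) => [j ->|->]; rewrite ?hS ?h0 => tE.
  apply/orP; right; rewrite tE; apply: map_f; apply/hs; split; last by exists j, i.
  by rewrite -up_gt -tE.
apply/orP; left; rewrite mem_lead_block ht tE leNgt entry_lt //.
by apply/and3P; split=> //; [apply/leadP; eexists | lia].
Qed.

(** The cost of passing the [e] entries of one quotient: [-q] for the entry with the same residue
    modulo [e], where [alpha] is 0, and [-1] for each of the others. *)
Definition lead_coeff : Qq := - q * (-1) ^+ e.-1.

(* A t coming from level r, at quotient n, exceeds exactly the entries of the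
   first component with quotient at most n, that is, each residue modulo e
   equally often. *)
Lemma prod_swap_coeff t : z < t -> up t <= top ->
  \prod_(p <- lead_block | p < up t) - swap_coeff e r.+1 p (up t) =
  lead_coeff ^+ `|(1 - n0 - wres_m e r t)%R|.
Proof.
have := @wres_m_le _ _ e_gt0 r_gt0 t n0.
have [a [b [n [ha hb ->]]]] := ptP e_gt0 r_gt0 t.
have [_ _ ->] := wres_pt e_gt0 r_gt0 n ha hb.
rewrite level_up_pt //; set u := pt e r.+1 a (b + 1) n => hn /hn {}hn ut.
have hb1 : 0 <= b + 1 < r.+1%:Z by lia.
set m := `|_|%N.
(* The quotients [n0], ..., [n] count in full. For [n] itself this holds because the first component
   has [b = 0], below [b + 1]. *)
have hm : m%:Z = n - n0 + 1 by lia.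
have ord_lt (i : 'I_e) : 0 <= (i : nat)%:Z < e%:Z by rewrite lez_nat ltz_nat /=.
have r_lt : (0 : int) <= 0 < r.+1%:Z by lia.
rewrite -big_filter.
rewrite (perm_big [seq pt e r.+1 (nat_of_ord i)%:Z 0 (n0 + j%:Z)
                  | j <- iota 0 m, i <- enum 'I_e]) /=.
  rewrite big_allpairs_dep /=.
  rewrite (eq_bigr (fun=> lead_coeff)) => [|j _].
    by rewrite big_const_seq count_predT size_iota iter_mulr_1.
  rewrite big_enum /=; have ha0 : (`|a| < e)%N by lia.
  rewrite (bigD1 (Ordinal ha0)) // /lead_coeff.
  have hal (i : 'I_e) : (alpha e r.+1 (pt e r.+1 (i : nat)%:Z 0 (n0 + j%:Z)) u == 0) =
      (i == `|a|%N :> nat).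
    have hee : e%:Z <= (e * r.+1)%N%:Z by rewrite lez_nat leq_pmulr.
    have hi := ord_lt i; rewrite alpha_pt //; apply/eqP/eqP; case: ltP; lia.
  have hbe (i : 'I_e) : (beta e r.+1 (pt e r.+1 (i : nat)%:Z 0 (n0 + j%:Z)) u == 0) = false.
    have heb : e%:Z * 1 <= e%:Z * (b + 1) by rewrite ler_wpM2l //; lia.
    have hi := ord_lt i; rewrite beta_pt //; apply/negbTE/eqP; case: ltP; lia.
  rewrite /swap_coeff hal hbe /= eqxx; congr (_ * _).
  rewrite (eq_bigr (fun=> -1)) => [|i hi].
    by rewrite prodr_const cardC1 card_ord.
  by rewrite hal hbe ifN.
apply: uniq_perm.
- by rewrite filter_uniq // gt_sorted_uniq_int // lead_block_sorted.
- apply: allpairs_uniq; rewrite ?iota_uniq ?enum_uniq // => -[j i] [j' i'] _ _ /= heq.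
  have [h1 _ h2] := wres_pt e_gt0 (ltn0Sn r) (n0 + j%:Z) (ord_lt i) r_lt.
  have [h3 _ h4] := wres_pt e_gt0 (ltn0Sn r) (n0 + j'%:Z) (ord_lt i') r_lt.
  rewrite heq in h1 h2.
  have -> : j = j' by lia.
  by congr (_, _); apply: val_inj => /=; lia.
move=> y; rewrite mem_filter mem_lead_block; apply/andP/allpairsPdep.
  case=> yu /and3P[lead_y zy _].
  have [a' [b' [n' [ha' hb' yE]]]] := ptP e_gt0 (ltn0Sn r) y.
  have := wres_m_le e_gt0 (ltn0Sn r) zy.
  have [_ _ wE] := wres_pt e_gt0 (ltn0Sn r) n' ha' hb'; rewrite yE wE lerN2 => hn'.
  move: lead_y; rewrite /lead yE; have [_ -> _] := wres_pt e_gt0 (ltn0Sn r) n' ha' hb'.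
  move=> b'0; have {}b'0 : b' = 0 by lia.
  have ha0 : (`|a'| < e)%N by lia.
  exists `|(n' - n0)%R|%N, (Ordinal ha0).
  move: yu; rewrite yE pt_lt // b'0 => yu.
  rewrite mem_iota mem_enum /=; split=> //; first by lia.
  have -> : n0 + `|(n' - n0)%R|%N%:Z = n' by lia.
  have -> : `|a'|%N%:Z = a' by lia.
  by [].
case=> j [i [+ _ ->]]; rewrite mem_iota /= => hj.
have yu : pt e r.+1 (i : nat)%:Z 0 (n0 + j%:Z) < u by rewrite pt_lt //; lia.
split=> //; rewrite (ltW (lt_le_trans yu ut)) andbT /lead.
have [_ -> _] := wres_pt e_gt0 (ltn0Sn r) (n0 + j%:Z) (ord_lt i) r_lt.
rewrite eqxx /= /pt.
have h2 : (e * r.+1)%N%:Z * n0 <= (e * r.+1)%N%:Z * (n0 + j%:Z) by rewrite ler_wpM2l //; lia.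
by lia.
Qed.

Local Notation B := lead_block.
Local Notation "x ≡ y" := (wedge_eq e r (charge st) x y) (at level 70).
Local Notation "x ≡' y" := (wedge_eq e r.+1 (charge st') x y) (at level 70).
Local Notation W s := (<< wcat z s >> : {malg Qq[wedge]}).
Local Notation W' s := (<< wcat z' s >> : {malg Qq[wedge]}).

Lemma prod_swap_coeffs s : all (> z) s -> all (fun t => up t <= top) s ->
  0 <= \sum_(t <- s) (1 - n0 - wres_m e r t) /\
  \prod_(t <- s) \prod_(p <- B | p < up t) - swap_coeff e r.+1 p (up t) =
  lead_coeff ^+ `|\sum_(t <- s) (1 - n0 - wres_m e r t)|.
Proof.
elim: s => [_ _|t s IH /= /andP[zt s_gt] /andP[t_top s_top]].
  by rewrite !big_nil.
have [sum_ge0 prodE] := IH s_gt s_top.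
have t_ge0 : 0 <= 1 - n0 - wres_m e r t.
  by have := wres_m_le e_gt0 r_gt0 zt; lia.
rewrite !big_cons prod_swap_coeff // prodE -exprD; split; first by rewrite addr_ge0.
congr (_ ^+ _); move: (\sum_(j <- s) _) sum_ge0 => S S_ge0; lia.
Qed.

Lemma charge_cons s : charge st = z + (size s)%:Z ->
  charge st' = z' + (size (B ++ map up s))%:Z.
Proof.
rewrite {2}/charge big_ord_recl tnth0 => hc.
under eq_bigr do rewrite tnthS.
rewrite -/(charge st) hc size_cat !size_map size_iota.
by lia.
Qed.

Lemma lead_block_full (p y : int) : p \in B -> lead p -> lead y -> p < y <= top -> y \in B.
Proof.
rewrite !mem_lead_block // => /and3P[_ zp _] _ -> /andP[py ->].
by rewrite (lt_trans zp py).
Qed.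

(* Straightening at level r and at level r + 1 go in parallel, so the same
   coefficients [D] occur on both sides. *)
Lemma expansion_add_empty (N : int) s : all (> z) s ->
  all (fun t => up t <= top) s ->
  (forall k : 'I_r, (count (fun t => wres_b e r t == k%:Z + 1) s)%:Z =
     tnth st k - e%:Z * n0) ->
  \sum_(t <- s) (1 - n0 - wres_m e r t) = N ->
  exists D : {malg Qq[multipartition r]},
    W s ≡ lincomb (fun lam => << ket e st lam >> : {malg Qq[wedge]}) D /\
    W' (B ++ map up s) ≡'
      lead_coeff ^+ `|N| *:
      lincomb (fun lam => << ket e st' (add_empty lam) >> : {malg Qq[wedge]}) D.
Proof.
elim/(@exchange_ind e r): s => [s hs s_gt s_top s_count sN|].
  have [lam [hdeep sE]] := multipartition_of_entries e_gt0 r_gt0 hs s_gt s_count.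
  exists << lam >>; rewrite !lincombU -(ket_wcat e_gt0 r_gt0 hdeep hs sE).
  split; first exact: wedge_eq_refl.
  have hdeep' := deep_add_empty hdeep.
  have [E hE E_above] := entries_above_exists e_gt0 (ltn0Sn r) hdeep'.
  have EB := (entries_above_add_empty E sE).1 E_above.
  rewrite -(ket_wcat e_gt0 (ltn0Sn r) hdeep' hE E_above).
  rewrite -sN; have [_ <-] := prod_swap_coeffs s_gt s_top.
  rewrite -(big_map up xpredT (fun t => \prod_(p <- B | p < t) - swap_coeff e r.+1 p t)).
  apply: (wcat_merge e_gt0 (ltn0Sn r) (hi := top)) => //.
  - exact: lead_block_sorted.
  - by rewrite sorted_map; apply: sub_sorted hs => x y /=; rewrite level_up_lt.
  - move=> _ /mapP [t ts ->]; rewrite lead_up //; split=> //; last exact: (allP s_top).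
    by rewrite mem_lead_block // lead_up.
  - by apply/allP => p; rewrite mem_lead_block // => /and3P[].
  - by move=> p t; rewrite mem_lead_block // => /and3P[].
  - exact: lead_block_full.
  - by apply: charge_cons; apply: charge_size s_count.
move=> s1 t u s2 htu IH s_gt s_top s_count sN.
have hc := charge_size e_gt0 r_gt0 s_count.
have hc' := charge_cons hc.
have mapE t' u' : B ++ map up (s1 ++ t' :: u' :: s2) =
  (B ++ map up s1) ++ up t' :: up u' :: map up s2 by rewrite map_cat -catA.
rewrite mapE in hc' *.
move: htu; rewrite le_eqVlt => /predU1P [tu|htu].
  (* With two equal adjacent entries both wedges vanish. *)
  exists 0; rewrite !lincomb0 scaler0 -tu in hc hc' *.
  by split; apply: wcat_diag.
pose F x y := W' ((B ++ map up s1) ++ x :: y :: map up s2).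
(* Working with pairs in the product module makes one closure argument yield a common [D] at both
   levels. The power of [lead_coeff] is the same for all terms, since exchanges preserve the sum of
   the quotients. *)
pose P (v : {malg Qq[wedge]} * {malg Qq[wedge]}) :=
  exists D : {malg Qq[multipartition r]},
    v.1 ≡ lincomb (fun lam => << ket e st lam >> : {malg Qq[wedge]}) D /\
    v.2 ≡' lead_coeff ^+ `|N| *:
      lincomb (fun lam => << ket e st' (add_empty lam) >> : {malg Qq[wedge]}) D.
pose V x := (W (s1 ++ (u - x) :: (t + x) :: s2), F (up (u - x)) (up (t + x))).
have P0 : P 0 by exists 0; rewrite !lincomb0 scaler0; split; apply: wedge_eq_refl.
have PD x y : P x -> P y -> P (x + y).
  move=> [D [h1 h2]] [D' [h1' h2']]; exists (D + D').
  by split; rewrite lincombD ?scalerDr; [exact: (wedge_eqD h1 h1') | exact: (wedge_eqD h2 h2')].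
have PZ d x : P x -> P (d *: x).
  move=> [D [h1 h2]]; exists (d *: D).
  split; first by rewrite lincombZ; exact: (wedge_eqZ d h1).
  by rewrite lincombZ scalerA mulrC -scalerA; exact: (wedge_eqZ d h2).
have PV x : exchange e r t u x -> P (V x).
  move=> hx; case: (hx) => x_ge0 hlt _ hb hm.
  have [|||| D [h1 h2]] := IH x hx.
  - by move: s_gt; rewrite !all_cat /= => /and4P[-> h1 h2 ->]; lia.
  - move: s_top; rewrite !all_cat /= => /and4P[-> h1 h2 ->].
    have hup a : a <= u -> up a <= top.
      by move=> hau; apply: le_trans h2; rewrite leNgt level_up_lt // -leNgt.
    by rewrite /= andbT; apply/andP; split; apply: hup; lia.
  - move=> k; rewrite -s_count !count_cat /=.
    by have /permP /(_ (fun b => b == k%:Z + 1)) /= := hb; lia.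
  - by rewrite -sN !big_cat !big_cons /=; lia.
  by exists D; split=> //; rewrite /= /F -mapE.
have := @straighten_closed e r e_gt0 r_gt0 _ P t u V P0 PD PZ (fun x _ => PV x).
move/PD => /(_ (- swap_coeff e r t u *: V 0)); rewrite scaleNr addrK.
case=> [|D []].
  by rewrite -scaleNr; apply/PZ/PV/exchange0.
rewrite !straighten_linear => h1 h2; exists D; split.
  exact: wedge_eq_trans (wcat_straighten e_gt0 r_gt0 hc (ltW htu)) h1.
have htu' : up t <= up u by rewrite leNgt level_up_lt // -leNgt ltW.
apply: wedge_eq_trans (wcat_straighten e_gt0 (ltn0Sn r) hc' htu') _.
by have := straighten_level_up e_gt0 r_gt0 t u F => /= ->.
Qed.

(** Collecting the [lead] entries of the reversed ket leaves them in increasing order;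
    [full_straighten] then turns them into [B] at the cost of a further scalar. *)
Lemma unshuffle_rev s E : sorted >%R s -> all (> z) s -> all (fun t => up t <= top) s ->
  sorted >%R E -> E =i B ++ map up s ->
  charge st = z + (size s)%:Z ->
  exists k, W' (rev E) ≡' k *: W' (B ++ map up (rev s)).
Proof.
move=> hs s_gt s_top hE memE hc; have hc' := charge_cons hc.
have up_sorted : sorted >%R (map up s).
  by rewrite sorted_map; apply: sub_sorted hs => x y /=; rewrite level_up_lt.
have E_lead : [seq y <- rev E | lead y] = rev B.
  rewrite filter_rev; congr rev; apply: gt_sorted_eq_int.
  - exact: (sorted_filter gt_int_trans).
  - exact: lead_block_sorted.
  move=> y; rewrite mem_filter memE mem_cat mem_lead_block //.
  case: (boolP (lead y)) => //= lead_y.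
  case: (boolP (_ \in map _ _)) => [/mapP [t _ yE]|_]; last by rewrite orbF.
  by rewrite yE lead_up in lead_y.
have E_nlead : [seq y <- rev E | ~~ lead y] = map up (rev s).
  rewrite filter_rev map_rev; congr rev; apply: gt_sorted_eq_int => //.
    exact: (sorted_filter gt_int_trans).
  move=> y; rewrite mem_filter memE mem_cat mem_lead_block //.
  case: (boolP (lead y)) => //= lead_y.
  by apply/esym/negP => /mapP [t _ yE]; rewrite yE lead_up in lead_y.
have E_size : size (rev E) = size (B ++ map up s).
  rewrite size_rev; apply/perm_size/uniq_perm => //; first exact: gt_sorted_uniq_int.
  rewrite cat_uniq !gt_sorted_uniq_int ?lead_block_sorted // andbT /=.
  by apply/hasPn => _ /mapP [t _ ->]; rewrite /= mem_lead_block // lead_up.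
have [||||k hk] := @wcat_unshuffle e r.+1 (charge st') z' e_gt0 (ltn0Sn r)
    (z' + 1) (rev E) _ _ _ [::].
- by rewrite rev_sorted.
- rewrite all_rev; apply/allP => y; rewrite memE mem_cat mem_lead_block //.
  by case/orP => [/and3P[] /=|/mapP [t /(allP s_gt) /= zt ->]]; last rewrite -up_gt in zt; lia.
- move=> p y; rewrite !mem_rev !memE !mem_cat.
  case/orP => [|/mapP [t _ ->]]; last by rewrite lead_up.
  rewrite !mem_lead_block // => /and3P[_ _ p_top] _ -> hy; apply/orP; left.
  by apply/and3P; split=> //; lia.
- by rewrite cats0 E_size.
rewrite !cats0 E_lead E_nlead in hk.
have [|||||l hl] := @full_straighten e r.+1 (charge st') z' e_gt0 (ltn0Sn r)
    (z' + 1) top B lead_block_sorted _ (rev B) _ _ _ (map up (rev s)).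
- by move=> y hy lead_y; rewrite mem_lead_block // lead_y /=; lia.
- by rewrite all_rev; apply/allP => y; rewrite mem_lead_block // => /and3P[_]; lia.
- by rewrite all_rev; apply/allP => y; rewrite mem_lead_block // => /and3P[].
- exact: size_rev.
- by rewrite hc' !size_cat size_rev !(size_map up) size_rev.
by exists (k * l); apply: wedge_eq_transr hk hl.
Qed.

End AddComponent.

(** * Comparison of the coefficients for a given multicharge *)

(** A gap of [e] forces distinct quotients, and the quotient dominates the order of the entries,
    whatever their components. *)
Lemma entry_lt_far e r (k k' : nat) (x y : int) : (0 < e)%N -> (k < r)%N ->
  (k' < r)%N -> x + e%:Z <= y -> entry e r k x < entry e r k' y.
Proof.
move=> e_gt0 hk hk'; have r_gt0 := leq_ltn_trans (leq0n _) hk.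
have [a [n [ha -> ->]]] := entry_pt r k x e_gt0.
have [a' [n' [ha' -> ->]]] := entry_pt r k' y e_gt0.
rewrite pt_lt // /pt => h; suff -> : n < n' by [].
rewrite ltNge; apply/negP => hn.
have h1 : e%:Z * n' <= e%:Z * n by rewrite ler_wpM2l.
by lia.
Qed.

(** The last equation is the charge formula with [n0 = - M]: a low threshold makes the segment as
    long as the coefficients require. *)
Lemma size_large (c : int) (K sz m M : nat) : (0 < K)%N -> (m + `|c| <= M)%N ->
  c = K%:Z * - M%:Z + sz%:Z -> (m <= sz)%N.
Proof.
rewrite mulrN => K_gt0 hm hc.
have h : M%:Z <= K%:Z * M%:Z by rewrite ler_peMl.
by lia.
Qed.

Section ChargedCoefficients.
Variables (e r : nat) (st : r.-tuple int) (st1 : int) (mu : multipartition r).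
Hypotheses (e_gt0 : (0 < e)%N) (r_gt0 : (0 < r)%N).
Hypothesis st1_large : forall k, beta_number mu st k 0 + e%:Z <= st1.
Local Notation st' := [tuple of st1 :: st].

(** Up to one scalar, the expansion at level [r + 1] is the image under [add_empty] of the one at
    level [r], and the scalar cancels in the quotient. *)
Lemma charged_bar_coeff_add_empty lam' lam b' b :
  is_charged_bar_coeff e st' lam' (add_empty mu) b' ->
  is_charged_bar_coeff e st lam mu b ->
  (lam' = add_empty lam -> b' = b) /\
  ((forall lam0, lam' != add_empty lam0) -> b' = 0).
Proof.
move=> [L' hL'] [L hL].
(* The threshold given by [- M] must be [deep] for [mu], lie below [st1], and leave segments of
   lengths at least [L] and [L']; the summands of [M] provide for these in turn. *)
pose M := (\sum_(k < r) (size (sval (tnth mu k)) + `|tnth st k|) + `|st1| + L + L'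
  + `|charge st| + `|charge st'|)%N.
pose n0 : int := - M%:Z.
have eM : M%:Z <= e%:Z * M%:Z by rewrite ler_peMl.
have hdeep : deep e st mu n0.
  move=> k; rewrite /n0 mulrN opprK.
  have : (size (sval (tnth mu k)) + `|tnth st k| <= M)%N.
    by rewrite /M (bigD1 k) //=; lia.
  by lia.
have st1_gt : e%:Z * n0 <= st1.
  rewrite /n0 mulrN.
  have : (`|st1| <= M)%N by rewrite /M; lia.
  by lia.
have [s hs sE] := entries_above_exists e_gt0 r_gt0 hdeep.
have hdeep' := deep_add_empty e_gt0 r_gt0 st1_gt hdeep.
have [E hE EE] := entries_above_exists e_gt0 (ltn0Sn r) hdeep'.
have memE := (entries_above_add_empty e_gt0 r_gt0 st1_gt E sE).1 EE.
have s_count k := count_component e_gt0 r_gt0 k hdeep (gt_sorted_uniq_int hs) sE.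
have E_count k := count_component e_gt0 (ltn0Sn r) k hdeep' (gt_sorted_uniq_int hE) EE.
have hc := charge_size e_gt0 r_gt0 s_count.
have hc' := charge_size e_gt0 (ltn0Sn r) E_count.
have s_gt : all (> ((e * r)%N%:Z * n0)) s by apply/allP => t /sE[].
have s_top : all (fun t => level_up e r t <= entry e r.+1 0 st1) s.
  apply/allP => t /sE[_ [k [i ->]]]; rewrite level_up_entry //; apply/ltW.
  apply: entry_lt_far; rewrite ?ltnS //; apply: le_trans _ (st1_large k); rewrite lerD2r.
  by have := part_nonincr (tnth mu k) (leq0n i); rewrite /beta_number; lia.
have s_size : (L <= size s)%N.
  by apply: (size_large _ _ hc); rewrite ?muln_gt0 ?e_gt0 // /M; lia.
have E_size : (L' <= size E)%N.
  by apply: (size_large _ _ hc'); rewrite ?muln_gt0 ?e_gt0 // /M; lia.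
have [c [hc1 c_mu bE]] := hL _ s_size.
have [c' [hc1' c'_mu b'E]] := hL' _ E_size.
rewrite -(ket_wcat e_gt0 r_gt0 hdeep hs sE) rev_prefix_wcat in hc1.
rewrite -(ket_wcat e_gt0 (ltn0Sn r) hdeep' hE EE) rev_prefix_wcat in hc1'.
have [k hk] := unshuffle_rev e_gt0 r_gt0 st1_gt hs s_gt s_top hE memE hc.
have [||| D [hD hD']] := @expansion_add_empty e r st st1 n0 e_gt0 r_gt0 st1_gt _
  (rev s) _ _ _ erefl.
- by rewrite all_rev.
- by rewrite all_rev.
- by move=> j; rewrite count_rev.
have := wedge_eq_transr hk hD'; set kH : Qq := _ * _ => hkH.
(* Both identifications rest on the uniqueness contained in [is_expansion]. *)
have c_D : c = D by apply: hc1.2.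
have c'_D : c' = (kH : Qq) *:
    lincomb (fun lam => << add_empty lam >> : {malg Qq[multipartition r.+1]}) D.
  apply: hc1'.2; rewrite -/(lincomb (fun lam => << ket e st' lam >> : {malg Qq[wedge]}) _).
  by rewrite lincombZ lincomb_comp.
(* The unspecified scalars cannot vanish, because the coefficient at [add_empty mu] is non-zero by
   assumption. *)
have kH_neq0 : kH != 0.
  by apply: contraNneq c'_mu => kH0; rewrite c'_D kH0 scale0r mcoeff0.
have add_inj := @add_empty_inj r.
split=> [lam'E|hlam'].
  rewrite b'E bE lam'E c'_D c_D !mcoeffZ !mcoeff_lincomb_inj //.
  by rewrite -mulf_div divff ?mul1r.
rewrite b'E c'_D mcoeffZ mcoeff_lincomb big1 ?mulr0 ?mul0r // => lam0 _.
by rewrite eq_sym (negPf (hlam' _)) mulr0.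
Qed.

End ChargedCoefficients.

(** * Dominant multicharges and conclusion *)

Lemma dominant_multicharge e r (s : r.-tuple 'Z_e) (N : int) : (2 <= e)%N ->
  exists2 st : r.-tuple int, is_multicharge s st &
    forall k k' : 'I_r, k' = k.+1 :> nat -> N <= tnth st k - tnth st k'.
Proof.
move=> he; pose D := (`|N| + 1)%N.
(* The representatives of the residues differ by less than [e], and each step adds [e D], that is
   [e] times the absolute value of [N] plus [e]. *)
exists [tuple (nat_of_ord (tnth s k) + e * (D * (r - k)))%N%:Z | k < r] => [k|k k' kk'].
  by rewrite tnth_mktuple -pmulrn natrD natrM pchar_Zp // mul0r addr0 natr_Zp.
rewrite !tnth_mktuple kk'.
have hD : (e * (D * (r - k)) = e * (D * (r - k.+1)) + e * D)%N.
  have -> : (r - k = (r - k.+1) + 1)%N by have := ltn_ord k'; rewrite kk'; lia.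
  by rewrite (mulnDr D (r - k.+1)%N) muln1 (mulnDr e (D * (r - k.+1))%N).
have h1 : (nat_of_ord (tnth s k') < e)%N.
  by have := ltn_ord (tnth s k'); rewrite [X in (_ < X)%N]Zp_cast.
have h2 : (e * D = e * `|N| + e)%N by rewrite /D mulnDr muln1.
have h3 : (`|N| <= e * `|N|)%N by rewrite leq_pmull //; lia.
by rewrite hD; lia.
Qed.

Theorem proposition3p1 (e r : nat) (he : (2 <= e)%N) (hr : (1 < r)%N)
    (s : r.-tuple 'Z_e)
    (b : multipartition r -> multipartition r -> Qq)
    (b_ : multipartition r.-1 -> multipartition r.-1 -> Qq)
    (hb : is_bar_coeffs s b)
    (hb_ : is_bar_coeffs (behead_tuple s) b_)
    (lam mu : multipartition r) (hmu : head emptypart mu = emptypart) :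
  b lam mu = if head emptypart lam == emptypart
             then b_ (behead_tuple lam) (behead_tuple mu)
             else 0.
Proof.
case: r hr s b b_ hb hb_ lam mu hmu => // r r_gt0 s b b_ hb hb_ lam mu hmu.
have e_gt0 : (0 < e)%N by apply: leq_trans he.
have tupleE (T : Type) (t : r.+1.-tuple T) x0 : t = [tuple of head x0 t :: behead_tuple t].
  by case/tupleP: t => x t; apply: val_inj.
have muE : mu = add_empty (behead_tuple mu) by rewrite {1}(tupleE _ mu emptypart) hmu.
have [N hN] := hb mu; have [N_ hN_] := hb_ (behead_tuple mu).
have [st st_s st_dom] := dominant_multicharge (behead_tuple s) (`|N| + `|N_|)%N%:Z he.
(* [X] makes [st1] dominate both the next component of the multicharge, by [N], and all the
   beta-numbers of [mu], by [e]. Multiplying it by [e] keeps the residue of [st1] equal to the first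
   component of [s]. *)
pose X := (`|N| +
  \sum_(k < r) (`|beta_number (behead_tuple mu) st k 0%N| + `|tnth st k|) + 1)%N.
pose st1 := (nat_of_ord (head (0%R : 'Z_e) s) + e * X)%N%:Z.
have X_le (k : 'I_r) :
    (`|N| + `|beta_number (behead_tuple mu) st k 0%N| + `|tnth st k| + 1 <= X)%N.
  by rewrite /X (bigD1 k) //=; lia.
have eX : (e + X <= e * X + 1)%N.
  have -> : (X = X.-1 + 1)%N by rewrite /X; lia.
  by rewrite mulnDr muln1; have := leq_pmull X.-1 e_gt0; lia.
have st1_large k : beta_number (behead_tuple mu) st k 0%N + e%:Z <= st1.
  by have := X_le k; rewrite /st1; lia.
have st'_s : is_multicharge s [tuple of st1 :: st].
  move=> k; rewrite [in RHS](tupleE _ s 0); case: (unliftP ord0 k) => [j ->|->].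
    by rewrite !tnthS; apply: st_s.
  by rewrite !tnth0 /st1 -pmulrn natrD natrM pchar_Zp // mul0r addr0 natr_Zp.
have st'_dom (k k' : 'I_r.+1) : k' = k.+1 :> nat ->
    N <= tnth [tuple of st1 :: st] k - tnth [tuple of st1 :: st] k'.
  have tnthE (j : 'I_r) : tnth [tuple of st1 :: st] (lift ord0 j) = tnth st j.
    exact: tnthS.
  case: (unliftP ord0 k') => [j' ->|-> //]; rewrite tnthE => kk'.
  case: (unliftP ord0 k) kk' => [j ->|->]; rewrite ?tnthE ?tnth0 => kk'.
    by apply: le_trans _ (st_dom j j' (succn_inj kk')); lia.
  have hX : X%:Z <= st1 by rewrite /st1; lia.
  by rewrite lerBrDr; apply: le_trans hX; have := X_le j'; lia.
have st_dom_ (k k' : 'I_r) : k' = k.+1 :> nat -> N_ <= tnth st k - tnth st k'.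
  by move/st_dom; lia.
have := hN _ st'_s st'_dom lam; rewrite {1}muE => h'.
have h := hN_ _ st_s st_dom_ (behead_tuple lam).
have [h1 h2] := charged_bar_coeff_add_empty e_gt0 r_gt0 st1_large h' h.
case: eqP => hlam; [apply: h1 | apply: h2].
  by rewrite {1}(tupleE _ lam emptypart) hlam.
by move=> lam0; apply/eqP => lamE; apply: hlam; rewrite lamE.
Qed.
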